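(* Let $(A,L,\alpha)$ be a Lie-Rinehart superalgebra and $\mathfrak L$ a Lie superalgebra (all over $\mathbb C$). Then any even crossed homomorphism $\mathcal H:L\to\mathfrak L\otimes A$ induces a left module category structure on the category $\mathbf{WMod}_A(L)$ of weak representations over the monoidal category $\mathbf{Mod}(\mathfrak L)$: $$F_{\mathcal H}:\mathbf{Mod}(\mathfrak L)\times\mathbf{WMod}_A(L)\to\mathbf{WMod}_A(L).$$ Here $F_{\mathcal H}(V,M)=V\otimes M$ with actions, for homogeneous $a\in A$, $x\in L$, $v\in V$, $m\in M$ and $\mathcal H(x)=\sum_i l_i\otimes a_i$ (with $l_i,a_i$ homogeneous), $$a\cdot(v\otimes m)=(-1)^{|a||v|}v\otimes(a\cdot m),\qquad x\cdot(v\otimes m)=(-1)^{|x||v|}v\otimes(x\cdot m)+\sum_i(-1)^{|a_i||v|}(l_i\cdot v)\otimes(a_i\cdot m),$$ and $F_{\mathcal H}(\varphi,\phi)=\varphi\otimes\phi$ on morphisms.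
   Context: Let $A$ be a unital associative supercommutative superalgebra over $\mathbb C$. A superderivation of degree $|f|$ is a homogeneous linear map $f:A\to A$ with $f(ab)=f(a)b+(-1)^{|a||f|}af(b)$; $s\mathrm{Der}(A)$ is the Lie superalgebra they span, with bracket $[f,g]=f\circ g-(-1)^{|f||g|}g\circ f$, and an $A$-module via $(a\cdot f)(b)=af(b)$. A Lie-Rinehart superalgebra is a triple $(A,L,\alpha)$ with $L$ a Lie superalgebra equipped with a ($\mathbb Z_2$-graded) $A$-module structure and $\alpha:L\to s\mathrm{Der}(A)$ an even map which is a homomorphism of Lie superalgebras and of $A$-modules, such that $[x,a\cdot y]=(-1)^{|a||x|}a\cdot[x,y]+\alpha(x)(a)\cdot y$. A weak representation of $(A,L,\alpha)$ is a $\mathbb Z_2$-graded vector space $M$ that is a graded $A$-module and a graded $L$-module with $x\cdot(a\cdot m)=\alpha(x)(a)\cdot m+(-1)^{|x||a|}a\cdot(x\cdot m)$; morphisms in $\mathbf{WMod}_A(L)$ are even linear maps that are both $A$-linear and $L$-linear. $\mathbf{Mod}(\mathfrak L)$ is the monoidal category of $\mathbb Z_2$-graded $\mathfrak L$-modules with even homomorphisms, tensor product action $l\cdot(v\otimes w)=l\cdot v\otimes w+(-1)^{|l||v|}v\otimes l\cdot w$, and unit the trivial module $\mathbb C$. An even crossed homomorphism is an even linear map $\mathcal H:L\to\mathfrak L\otimes A$ such that for homogeneous $x,y\in L$ $$\mathcal H([x,y])=x\star\mathcal H(y)-(-1)^{|x||y|}y\star\mathcal H(x)+[\mathcal H(x),\mathcal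 H(y)],$$ where $x\star(l\otimes a)=(-1)^{|x||l|}l\otimes\alpha(x)(a)$ and $[l\otimes a,l'\otimes b]=(-1)^{|a||l'|}[l,l']\otimes ab$. A left module category over a monoidal category $\mathcal D$ is a category $\mathcal M$ with a bifunctor $\vartriangleright:\mathcal D\times\mathcal M\to\mathcal M$ and natural isomorphisms $(U\otimes V)\vartriangleright Z\cong U\vartriangleright(V\vartriangleright Z)$ and $I\vartriangleright Z\cong Z$ satisfying the usual pentagon and triangle axioms. Here the constraints are the canonical associativity and unit isomorphisms of super vector spaces. *)

(* Defs.v *)
From HB Require Import structures.
From mathcomp Require Import all_boot all_order all_algebra.
From mathcomp Require Import generic_quotient ring_quotient.
From mathcomp Require Import boolp reals complex freeg.

Set Implicit Arguments.
Unset Strict Implicit.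
Unset Printing Implicit Defensive.

Import GRing.Theory.
Local Open Scope ring_scope.
Local Open Scope quotient_scope.

(* Everything is defined over an arbitrary field K; the superspaces of        *)
(* interest are those over R[i], with R : realType.                           *)

(* A Z/2-grading V = V_0 (+) V_1 is given by its two projections: [spart p] is *)
(* the projection onto V_p, and V_p is its image.  Parities are booleans      *)
(* (true = odd), added with (+).                                              *)
HB.mixin Record Lmodule_isSuper (K : fieldType) V of GRing.Lmodule K V := {
  spart : bool -> V -> V;
  spart_linear : forall p, linear (spart p);
  spart_proj : forall p q v,
    spart p (spart q v) = if p == q then spart q v else 0;
  spart_sum : forall v, spart false v + spart true v = v }.
#[short(type="superType")]
HB.structure Definition Super (K : fieldType) :=
  {V of GRing.Lmodule K V & Lmodule_isSuper K V}.

HB.instance Definition _ (K : fieldType) (V : superType K) (p : bool) :=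
  GRing.isLinear.Build K V V _ (spart (s := V) p) (spart_linear p).

(* v is homogeneous of degree p; the vector 0 is homogeneous of both degrees. *)
Definition homog (K : fieldType) (V : superType K) (p : bool) (v : V) : Prop :=
  spart p v = v.

(* (-1)^(p q) *)
Definition ksgn (K : fieldType) (p q : bool) : K := (-1) ^+ (p && q).

Definition even_fun (K : fieldType) (V W : superType K) (f : V -> W) : Prop :=
  forall p v, homog p v -> homog p (f v).

Section BilinearDef.
Variables (K : fieldType) (U V W : lmodType K).
Definition is_bilinear (b : U -> V -> W) : Prop :=
  (forall v, linear (fun u => b u v)) /\ (forall u, linear (b u)).
End BilinearDef.

Definition graded_bilinear (K : fieldType) (U V W : superType K)
    (b : U -> V -> W) : Prop :=
  is_bilinear b /\
  (forall p q u v, homog p u -> homog q v -> homog (p (+) q) (b u v)).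

(* The product is not taken from the library's [algType], because those       *)
(* algebras are required to satisfy 1 != 0.                                   *)
HB.mixin Record Super_isSuperComAlgebra (K : fieldType) A of Super K A := {
  sone : A;
  smul : A -> A -> A;
  smul_graded : graded_bilinear smul;
  sone_even : homog false sone;
  smulA : associative smul;
  smul1s : left_id sone smul;
  smuls1 : right_id sone smul;
  smulC : forall p q (a b : A), homog p a -> homog q b ->
    smul a b = ksgn K p q *: smul b a }.
#[short(type="superComAlgType")]
HB.structure Definition SuperComAlgebra (K : fieldType) :=
  {A of Super_isSuperComAlgebra K A & Super K A}.

HB.mixin Record Super_isLieSuperalgebra (K : fieldType) L of Super K L := {
  sbr : L -> L -> L;
  sbr_graded : graded_bilinear sbr;
  sbrC : forall p q (x y : L), homog p x -> homog q y ->
    sbr x y = - (ksgn K p q *: sbr y x);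
  sbr_jacobi : forall p q r (x y z : L), homog p x -> homog q y -> homog r z ->
    sbr x (sbr y z) = sbr (sbr x y) z + ksgn K p q *: sbr y (sbr x z) }.
#[short(type="lieSuperType")]
HB.structure Definition LieSuperalgebra (K : fieldType) :=
  {L of Super_isLieSuperalgebra K L & Super K L}.

Section LieRinehart.
Variable K : fieldType.

(* f is a homogeneous element of sDer(A) of degree p. *)
Definition superderivation (A : superComAlgType K) (p : bool) (f : A -> A) :
    Prop :=
  [/\ linear f,
      forall q a, homog q a -> homog (p (+) q) (f a)
    & forall q a b, homog q a ->
        f (smul a b) = smul (f a) b + ksgn K q p *: smul a (f b)].

(* The bracket of sDer(A) on elements of degrees p and q. *)
Definition sder_bracket (A : superComAlgType K) (p q : bool) (f g : A -> A) :
    A -> A :=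
  fun a => f (g a) - ksgn K p q *: g (f a).

Definition is_graded_Amodule (A : superComAlgType K) (M : superType K)
    (act : A -> M -> M) : Prop :=
  [/\ graded_bilinear act,
      forall m, act (sone : A) m = m
    & forall a b m, act (smul a b) m = act a (act b m)].

Definition is_graded_Lmodule (L : lieSuperType K) (M : superType K)
    (act : L -> M -> M) : Prop :=
  graded_bilinear act /\
  (forall p q x y m, homog p x -> homog q y ->
     act (sbr x y) m = act x (act y m) - ksgn K p q *: act y (act x m)).

(* The anchor is the even map L -> sDer(A) written as L -> A -> A; since it    *)
(* maps L_p to sDer(A)_p, its values lie in sDer(A).                          *)
Definition is_lie_rinehart (A : superComAlgType K) (L : lieSuperType K)
    (act : A -> L -> L) (anchor : L -> A -> A) : Prop :=
  [/\ is_graded_Amodule act,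
      [/\ forall b, linear (fun x => anchor x b),
          forall p x, homog p x -> superderivation p (anchor x)
        & forall p q x y, homog p x -> homog q y ->
            anchor (sbr x y) =1 sder_bracket p q (anchor x) (anchor y)],
      forall a x b, anchor (act a x) b = smul a (anchor x b)
    & forall p q a x y, homog p a -> homog q x ->
        sbr x (act a y) = ksgn K p q *: act a (sbr x y) + act (anchor x a) y].

Record lie_rinehart (A : superComAlgType K) (L : lieSuperType K) := LieRinehart {
  lr_act : A -> L -> L;
  lr_anchor : L -> A -> A;
  lr_axioms : is_lie_rinehart lr_act lr_anchor }.

Definition is_weak_rep (A : superComAlgType K) (L : lieSuperType K)
    (E : lie_rinehart A L) (M : superType K)
    (actA : A -> M -> M) (actL : L -> M -> M) : Prop :=
  [/\ is_graded_Amodule actA,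
      is_graded_Lmodule actL
    & forall p q x a m, homog p x -> homog q a ->
        actL x (actA a m) =
          actA (lr_anchor E x a) m + ksgn K p q *: actA a (actL x m)].

Record lie_module (g : lieSuperType K) := LieModule {
  lm_sort :> superType K;
  lm_act : g -> lm_sort -> lm_sort;
  lm_axioms : is_graded_Lmodule lm_act }.

Record lie_module_hom (g : lieSuperType K) (V W : lie_module g) := LieModuleHom {
  lm_fun :> V -> W;
  lm_fun_linear : linear lm_fun;
  lm_fun_even : even_fun lm_fun;
  lm_fun_act : forall x v, lm_fun (lm_act x v) = lm_act x (lm_fun v) }.

Record weak_rep (A : superComAlgType K) (L : lieSuperType K)
    (E : lie_rinehart A L) := WeakRep {
  wr_sort :> superType K;
  wr_actA : A -> wr_sort -> wr_sort;
  wr_actL : L -> wr_sort -> wr_sort;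
  wr_axioms : is_weak_rep E wr_actA wr_actL }.

Record weak_rep_hom (A : superComAlgType K) (L : lieSuperType K)
    (E : lie_rinehart A L) (M N : weak_rep E) := WeakRepHom {
  wr_fun :> M -> N;
  wr_fun_linear : linear wr_fun;
  wr_fun_even : even_fun wr_fun;
  wr_fun_actA : forall a m, wr_fun (wr_actA a m) = wr_actA a (wr_fun m);
  wr_fun_actL : forall x m, wr_fun (wr_actL x m) = wr_actL x (wr_fun m) }.

End LieRinehart.

(* The tensor product over K: the free K-module on V * W modulo the submodule *)
(* spanned by the bilinearity relations.                                      *)
Section Tensor.
Variables (K : fieldType) (V W : lmodType K).

Local Notation free := {freeg (V * W)%type / K}.
Local Notation gen v w := (<< (v, w) >> : free).

Inductive tensor_rel : free -> Prop :=
| TensorDl v v' w : tensor_rel (gen (v + v') w - gen v w - gen v' w)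
| TensorDr v w w' : tensor_rel (gen v (w + w') - gen v w - gen v w')
| TensorZl k v w : tensor_rel (gen (k *: v) w - k *: gen v w)
| TensorZr k v w : tensor_rel (gen v (k *: w) - k *: gen v w).

Inductive tensor_null : free -> Prop :=
| TensorNull0 : tensor_null 0
| TensorNullS k x y :
    tensor_rel x -> tensor_null y -> tensor_null (k *: x + y).

Definition tensor_nullb : {pred free} := fun x => `[< tensor_null x >].

Lemma tensor_null_rel x : tensor_rel x -> tensor_null x.
Proof.
by move=> h; rewrite -[x]scale1r -[_ *: x]addr0; apply: TensorNullS h TensorNull0.
Qed.

Lemma tensor_nullD x y : tensor_null x -> tensor_null y -> tensor_null (x + y).
Proof.
by elim=> [|k z t hz _ IH] hy; rewrite ?add0r // -addrA; apply/TensorNullS/IH.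
Qed.

Lemma tensor_nullZ k x : tensor_null x -> tensor_null (k *: x).
Proof.
elim=> [|l z t hz _ IH]; first by rewrite scaler0; apply: TensorNull0.
by rewrite scalerDr scalerA; apply: TensorNullS.
Qed.

Fact tensor_nullb_closed : zmod_closed tensor_nullb.
Proof.
split=> [|x y]; first by apply/asboolP; apply: TensorNull0.
move=> /asboolP hx /asboolP hy; apply/asboolP/tensor_nullD => //.
by rewrite -scaleN1r; apply: tensor_nullZ.
Qed.

HB.instance Definition _ :=
  GRing.isZmodClosed.Build free tensor_nullb tensor_nullb_closed.

Definition tensor : Type := Quotient.quot tensor_nullb.

HB.instance Definition _ := Choice.on tensor.
HB.instance Definition _ := GRing.Zmodule.on tensor.

Definition tproj (x : free) : tensor := \pi_(Quotient.quot tensor_nullb) x.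

Lemma tprojD x y : tproj (x + y) = tproj x + tproj y.
Proof. by rewrite /tproj piE. Qed.

Lemma tprojP x y : tproj x = tproj y <-> tensor_null (x - y).
Proof.
rewrite /tproj; split=> [/eqP|h].
  by rewrite -Quotient.idealrBE => /asboolP.
by apply/eqP; rewrite -Quotient.idealrBE; apply/asboolP.
Qed.

Lemma tproj_repr (t : tensor) : tproj (repr (t : Quotient.quot tensor_nullb)) = t.
Proof. by rewrite /tproj reprK. Qed.

Definition tscale (k : K) (t : tensor) : tensor :=
  tproj (k *: repr (t : Quotient.quot tensor_nullb)).

Lemma tprojZ k x : tproj (k *: x) = tscale k (tproj x).
Proof.
apply/tprojP; rewrite -scalerBr; apply: tensor_nullZ.
by apply/tprojP; rewrite tproj_repr.
Qed.

Lemma tproj_ind (P : tensor -> Prop) : (forall x, P (tproj x)) -> forall t, P t.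
Proof. by move=> h t; rewrite -(tproj_repr t). Qed.

Fact tscaleA k l t : tscale k (tscale l t) = tscale (k * l) t.
Proof. by elim/tproj_ind: t => x; rewrite -!tprojZ scalerA. Qed.
Fact tscale1 : left_id 1 tscale.
Proof. by elim/tproj_ind=> x; rewrite -tprojZ scale1r. Qed.
Fact tscaleDr : right_distributive tscale +%R.
Proof.
move=> k; elim/tproj_ind=> x; elim/tproj_ind=> y.
by rewrite -tprojD -!tprojZ -tprojD scalerDr.
Qed.
Fact tscaleDl t : {morph tscale^~ t : k l / k + l}.
Proof. by elim/tproj_ind: t => x k l; rewrite -!tprojZ -tprojD scalerDl. Qed.

HB.instance Definition _ := GRing.Zmodule_isLmodule.Build K tensor
  tscaleA tscale1 tscaleDr tscaleDl.

Definition tens (v : V) (w : W) : tensor := tproj (gen v w).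

Lemma tproj_linear : linear tproj.
Proof. by move=> k x y; rewrite tprojD tprojZ. Qed.
HB.instance Definition _ := GRing.isLinear.Build K free tensor _ tproj tproj_linear.

Lemma tproj_rel x : tensor_rel x -> tproj x = 0.
Proof.
move=> h; rewrite -[RHS](linear0 (@tproj)); apply/tprojP.
by rewrite subr0; apply: tensor_null_rel.
Qed.

Lemma tens_bilinear : is_bilinear tens.
Proof.
split=> [w k v v'|v k w w']; rewrite /tens.
- have /eqP := tproj_rel (TensorDl (k *: v) v' w).
  rewrite !linearB /= -addrA -opprD subr_eq0 => /eqP ->; congr (_ + _).
  by have /eqP := tproj_rel (TensorZl k v w); rewrite linearB linearZ /= subr_eq0 => /eqP.
- have /eqP := tproj_rel (TensorDr v (k *: w) w').
  rewrite !linearB /= -addrA -opprD subr_eq0 => /eqP ->; congr (_ + _).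
  by have /eqP := tproj_rel (TensorZr k v w); rewrite linearB linearZ /= subr_eq0 => /eqP.
Qed.

Lemma tens_ind (P : tensor -> Prop) :
    P 0 -> (forall v w t, P t -> P (tens v w + t)) -> forall t, P t.
Proof.
move=> P0 PS; elim/tproj_ind=> x; rewrite -[x]freeg_sumE.
elim: (dom x) => [|[v w] s IH]; first by rewrite big_nil linear0.
rewrite big_cons linearD /=.
suff -> : tproj << coeff (v, w) x *g (v, w) >> = tens (coeff (v, w) x *: v) w.
  exact: PS.
have /eqP := tproj_rel (TensorZl (coeff (v, w) x) v w).
rewrite linearB subr_eq0 /tens => /eqP ->; congr tproj.
by apply/eqP/freeg_eqP=> u; rewrite coeffZ !coeffU mul1r.
Qed.

Lemma tens_ext (U : zmodType) (f g : tensor -> U) :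
    {morph f : x y / x + y} -> {morph g : x y / x + y} ->
    (forall v w, f (tens v w) = g (tens v w)) -> f =1 g.
Proof.
move=> fD gD h; apply: tens_ind => [|v w t IH]; last by rewrite fD gD h IH.
apply: (addrI (f 0)); rewrite -fD addr0.
have -> : f 0 = 0 by apply: (addrI (f 0)); rewrite -fD !addr0.
by rewrite add0r; apply: (addrI (g 0)); rewrite -gD !addr0.
Qed.

Definition tlift (U : lmodType K) (b : V -> W -> U) (t : tensor) : U :=
  fglift (fun u => b u.1 u.2) (repr (t : Quotient.quot tensor_nullb)).

Section Lift.
Variables (U : lmodType K) (b : V -> W -> U).
Hypothesis b_bilin : is_bilinear b.
Let f := (fun u => b u.1 u.2).

Let fgB : {morph fglift f : x y / x - y}.
Proof. exact: lift_is_additive. Qed.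

Let fg0 : fglift f 0 = 0.
Proof. by rewrite -(subrr 0) fgB subrr. Qed.

Let fgD : {morph fglift f : x y / x + y}.
Proof.
have fgN z : fglift f (- z) = - fglift f z by rewrite -sub0r fgB fg0 sub0r.
by move=> x y; rewrite -{1}[y]opprK fgB fgN opprK.
Qed.

Let fgliftZ k x : fglift f (k *: x) = k *: fglift f x.
Proof.
rewrite -[x]freeg_sumE; elim: (dom x) => [|u s IH].
  by rewrite !big_nil scaler0 fg0 scaler0.
rewrite big_cons scalerDr !fgD scalerDr IH; congr (_ + _).
have -> : k *: << coeff u x *g u >> = << k * coeff u x *g u >> :> free.
  by apply/eqP/freeg_eqP=> z; rewrite coeffZ !coeffU mulrA.
by rewrite !liftU scalerA.
Qed.

Let fgliftP : linear (fglift f).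
Proof. by move=> k x y; rewrite -fgliftZ -fgD. Qed.

Let lift_null x : tensor_null x -> fglift f x = 0.
Proof.
have [bl br] := b_bilin.
have fgen v w : fglift f << (v, w) >> = b v w by rewrite liftU scale1r.
elim=> [|k y z hy _ IH]; first exact: fg0.
rewrite fgliftP IH addr0; suff -> : fglift f y = 0 by rewrite scaler0.
case: hy => [v v' w|v w w'|l v w|l v w]; rewrite !fgB ?fgliftZ !fgen.
- by have /= := bl w 1 v v'; rewrite !scale1r => ->; rewrite -addrA -opprD subrr.
- by have /= := br v 1 w w'; rewrite !scale1r => ->; rewrite -addrA -opprD subrr.
- have b0 : b 0 w = 0 by have /= := bl w (-1) 0 0; rewrite scaleN1r oppr0 addr0 scaleN1r addNr.
  by have /= := bl w l v 0; rewrite b0 !addr0 => ->; rewrite subrr.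
- have b0 : b v 0 = 0 by have /= := br v (-1) 0 0; rewrite scaleN1r oppr0 addr0 scaleN1r addNr.
  by have /= := br v l w 0; rewrite b0 !addr0 => ->; rewrite subrr.
Qed.

Let tlift_proj x : tlift b (tproj x) = fglift f x.
Proof.
apply/eqP; rewrite -subr_eq0 -fgB.
by apply/eqP/lift_null/tprojP; rewrite tproj_repr.
Qed.

Lemma tlift_linear : linear (tlift b).
Proof.
move=> k; elim/tproj_ind=> x; elim/tproj_ind=> y.
by rewrite -linearP /= !tlift_proj fgliftP.
Qed.

Lemma tlift_tens v w : tlift b (tens v w) = b v w.
Proof. by rewrite tlift_proj liftU scale1r. Qed.

End Lift.
End Tensor.

Section LinearFacts.
Variables (K : fieldType) (V W : lmodType K) (f : V -> W).
Hypothesis f_lin : linear f.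
Lemma lin_add : {morph f : x y / x + y}.
Proof. by move=> x y; have := f_lin 1 x y; rewrite !scale1r. Qed.
Lemma lin_zero : f 0 = 0.
Proof. by apply: (addrI (f 0)); rewrite -lin_add !addr0. Qed.
Lemma lin_scale k : {morph f : x / k *: x}.
Proof. by move=> x; have := f_lin k x 0; rewrite lin_zero !addr0. Qed.
End LinearFacts.

Lemma linear_compose (K : fieldType) (U V W : lmodType K) (f : V -> W) (g : U -> V) :
  linear f -> linear g -> linear (fun u => f (g u)).
Proof. by move=> fl gl k x y; rewrite gl fl. Qed.

Lemma linear_plus (K : fieldType) (V W : lmodType K) (f g : V -> W) :
  linear f -> linear g -> linear (fun v => f v + g v).
Proof. by move=> fl gl k x y; rewrite fl gl scalerDr addrACA. Qed.

Lemma linear_idfun (K : fieldType) (V : lmodType K) : linear (fun v : V => v).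
Proof. by []. Qed.

Lemma bilinear_add (K : fieldType) (U V W : lmodType K) (b c : U -> V -> W) :
  is_bilinear b -> is_bilinear c -> is_bilinear (fun u v => b u v + c u v).
Proof.
case=> b1 b2 [c1 c2]; split=> [v|u].
  exact: linear_plus (b1 v) (c1 v).
exact: linear_plus (b2 u) (c2 u).
Qed.

Lemma bilinear_comp (K : fieldType) (U U' V V' W : lmodType K) (b : U -> V -> W)
    (f : U' -> U) (g : V' -> V) :
  is_bilinear b -> linear f -> linear g -> is_bilinear (fun u v => b (f u) (g v)).
Proof.
case=> b1 b2 fl gl; split=> [v|u].
  exact: (@linear_compose _ _ _ _ (fun u => b u (g v)) f (b1 _) fl).
exact: (@linear_compose _ _ _ _ (b (f u)) g (b2 _) gl).
Qed.

Lemma bilinear_post (K : fieldType) (U V W W' : lmodType K) (b : U -> V -> W)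
    (f : W -> W') :
  is_bilinear b -> linear f -> is_bilinear (fun u v => f (b u v)).
Proof. by case=> b1 b2 fl; split=> [v|u];
  [exact: linear_compose fl (b1 v)|exact: linear_compose fl (b2 u)]. Qed.

Lemma tlift_linear_param (K : fieldType) (X V W U : lmodType K)
    (b : X -> V -> W -> U) :
  (forall x, is_bilinear (b x)) -> (forall v w, linear (fun x => b x v w)) ->
  forall t, linear (fun x => tlift (b x) t).
Proof.
move=> bb bl t k x y; have ad z := lin_add (tlift_linear (bb z)).
move: t; apply: tens_ext => [s t|s t|v w]; first exact: ad.
  by rewrite !ad scalerDr addrACA.
by rewrite !tlift_tens ?bl.
Qed.

Section TensLinear.
Variables (K : fieldType) (V W : lmodType K).
Lemma tensDl (v v' : V) (w : W) : tens (v + v') w = tens v w + tens v' w.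
Proof. exact: (lin_add ((tens_bilinear V W).1 w)). Qed.
Lemma tensDr (v : V) (w w' : W) : tens v (w + w') = tens v w + tens v w'.
Proof. exact: (lin_add ((tens_bilinear V W).2 v)). Qed.
Lemma tensZl k (v : V) (w : W) : tens (k *: v) w = k *: tens v w.
Proof. exact: (lin_scale ((tens_bilinear V W).1 w)). Qed.
Lemma tensZr k (v : V) (w : W) : tens v (k *: w) = k *: tens v w.
Proof. exact: (lin_scale ((tens_bilinear V W).2 v)). Qed.
Lemma tens0l (w : W) : tens (0 : V) w = 0.
Proof. exact: (lin_zero ((tens_bilinear V W).1 w)). Qed.
Lemma tens0r (v : V) : tens v (0 : W) = 0.
Proof. exact: (lin_zero ((tens_bilinear V W).2 v)). Qed.
End TensLinear.

Section SuperFacts.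
Variable K : fieldType.
Implicit Types V W : superType K.

Lemma homog_spart V p (v : V) : homog p (spart p v).
Proof. by rewrite /homog spart_proj eqxx. Qed.

Lemma spart_homog V p q (v : V) : homog q v -> spart p v = if p == q then v else 0.
Proof. by move=> <-; rewrite spart_proj. Qed.

Lemma homogZ V p k (v : V) : homog p v -> homog p (k *: v).
Proof. by rewrite /homog linearZ /= => ->. Qed.

Lemma homogD V p (v w : V) : homog p v -> homog p w -> homog p (v + w).
Proof. by rewrite /homog linearD /= => -> ->. Qed.

Lemma spart_sumb V p (v : V) : spart p v + spart (~~ p) v = v.
Proof. by case: p; rewrite /= ?spart_sum // addrC spart_sum. Qed.

Lemma ksgn_add p q r : ksgn K (p (+) q) r = ksgn K p r * ksgn K q r.
Proof. by case: p; case: q; case: r; rewrite /ksgn /= ?expr0 ?mul1r ?mulr1 ?mulrNN ?expr1 ?mulr1. Qed.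

Lemma ksgnC p q : ksgn K p q = ksgn K q p.
Proof. by rewrite /ksgn andbC. Qed.

Lemma ksgn_sqr p q : ksgn K p q * ksgn K p q = 1.
Proof. by rewrite /ksgn -signr_addb addbb. Qed.

(* The linear map equal to (-1)^(p |v|) v on homogeneous v. *)
Definition twist V (p : bool) (v : V) : V :=
  spart false v + ksgn K p true *: spart true v.

Lemma twist_homog V p q (v : V) : homog q v -> twist p v = ksgn K p q *: v.
Proof.
move=> hv; rewrite /twist !(spart_homog _ hv) /ksgn.
by case: q hv => hv; rewrite /= ?add0r ?scaler0 ?addr0 ?andbT ?andbF ?scale1r.
Qed.

Lemma twist_linear V p : linear (@twist V p).
Proof.
by move=> k x y; rewrite /twist !linearP /= !scalerDr addrACA !scalerA mulrC.
Qed.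

End SuperFacts.

Section TensorSuper.
Variables (K : fieldType) (V W : superType K).

Definition tspart (p : bool) : tensor V W -> tensor V W :=
  tlift (fun v w => tens (spart false v) (spart p w)
                    + tens (spart true v) (spart (~~ p) w)).

Let tspart_bilin p : is_bilinear (fun (v : V) (w : W) =>
  tens (spart false v) (spart p w) + tens (spart true v) (spart (~~ p) w)).
Proof.
have tb := tens_bilinear V W; have sl := @spart_linear K.
by apply: bilinear_add; apply: (bilinear_comp tb (sl _ _) (sl _ _)).
Qed.

Fact tspart_linear p : linear (tspart p).
Proof. exact: tlift_linear. Qed.

Fact tspart_proj p q t :
  tspart p (tspart q t) = if p == q then tspart q t else 0.
Proof.
have ad r := lin_add (tspart_linear r).
move: t; apply: tens_ext => [s t|s t|v w]; first by rewrite !ad.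
  by case: eqP => _; rewrite ?addr0 ?ad.
rewrite /tspart tlift_tens // -/(tspart p) ad /tspart !tlift_tens // !spart_proj /=.
rewrite !tens0l !(addr0, add0r).
by case: p; case: q; rewrite /= ?tens0r ?addr0.
Qed.

Fact tspart_sum t : tspart false t + tspart true t = t.
Proof.
have ad r := lin_add (tspart_linear r).
move: t; apply: tens_ext => [s t|//|v w]; first by rewrite !ad addrACA.
rewrite /tspart !tlift_tens //= addrACA -!tensDr [spart true w + _]addrC.
by rewrite !spart_sum -tensDl spart_sum.
Qed.

HB.instance Definition _ := Lmodule_isSuper.Build K (tensor V W)
  tspart_linear tspart_proj tspart_sum.

Lemma homog_tens p q (v : V) (w : W) :
  homog p v -> homog q w -> homog (p (+) q) (tens v w).
Proof.
move=> hv hw; rewrite /homog [LHS]tlift_tens // !(spart_homog _ hv) !(spart_homog _ hw).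
by case: p hv => hv; case: q hw => hw; rewrite /= ?tens0l ?tens0r ?addr0 ?add0r.
Qed.

Lemma tens_ext_homog (U : zmodType) (f g : tensor V W -> U) :
    {morph f : x y / x + y} -> {morph g : x y / x + y} ->
    (forall p q v w, homog p v -> homog q w -> f (tens v w) = g (tens v w)) ->
  f =1 g.
Proof.
move=> fD gD h; apply: tens_ext => // v w.
rewrite -(spart_sum v) -(spart_sum w) !tensDl !tensDr !fD !gD.
by rewrite !(h _ _ _ _ (homog_spart _ _) (homog_spart _ _)).
Qed.

Lemma tensor_graded (U : superType K) r (f : tensor V W -> U) : linear f ->
    (forall p q v w, homog p v -> homog q w ->
       homog (r (+) (p (+) q)) (f (tens v w))) ->
  forall p t, homog p t -> homog (r (+) p) (f t).
Proof.
move=> fl h p t <-; rewrite /homog; move: t.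
have fD := lin_add fl.
apply: tens_ext_homog => [s t|s t|q s v w hv hw]; rewrite ?linearD ?fD ?linearD //.
have hvw := homog_tens hv hw; rewrite (spart_homog _ hvw).
case: eqP => [->|_]; first exact: h.
by rewrite (lin_zero fl) linear0.
Qed.

End TensorSuper.

Section Trivial.
Variable K : fieldType.
Definition triv_spart (p : bool) (c : K^o) : K^o := if p then 0 else c.
Fact triv_spart_linear p : linear (triv_spart p).
Proof. by move=> k x y; case: p; rewrite /= ?scaler0 ?addr0. Qed.
Fact triv_spart_proj p q c :
  triv_spart p (triv_spart q c) = if p == q then triv_spart q c else 0.
Proof. by case: p; case: q. Qed.
Fact triv_spart_sum c : triv_spart false c + triv_spart true c = c.
Proof. exact: addr0. Qed.
HB.instance Definition _ := Lmodule_isSuper.Build K K^o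
  triv_spart_linear triv_spart_proj triv_spart_sum.
End Trivial.

Section CrossedHom.
Variables (K : fieldType) (A : superComAlgType K) (L g : lieSuperType K).
Variable E : lie_rinehart A L.

(* x * (l (x) a) = (-1)^(|x||l|) l (x) alpha(x)(a), extended to all x by      *)
(* splitting x into its homogeneous components.                               *)
Definition crossed_act (x : L) : tensor g A -> tensor g A :=
  tlift (fun l a => tens (twist false l) (lr_anchor E (spart false x) a)
                    + tens (twist true l) (lr_anchor E (spart true x) a)).

(* [l (x) a, l' (x) b] = (-1)^(|a||l'|) [l, l'] (x) ab *)
Definition tensor_br (s t : tensor g A) : tensor g A :=
  tlift (fun l a =>
    tlift (fun l' b => tens (sbr l (twist false l')) (smul (spart false a) b)
                       + tens (sbr l (twist true l')) (smul (spart true a) b))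
      t) s.

Lemma anchor_linear x : linear (lr_anchor E x).
Proof.
have [_ [al ad _] _ _] := lr_axioms E; move=> k a b.
have sp z := lin_add (al z); rewrite -(spart_sum x) !sp.
have [l0 _ _] := ad _ _ (homog_spart false x).
have [l1 _ _] := ad _ _ (homog_spart true x).
by rewrite l0 l1 scalerDr addrACA.
Qed.

Lemma crossed_act_bilin x : is_bilinear (fun (l : g) (a : A) =>
  tens (twist false l) (lr_anchor E (spart false x) a)
  + tens (twist true l) (lr_anchor E (spart true x) a)).
Proof.
have tb := tens_bilinear g A; have tl := @twist_linear K g.
by apply: bilinear_add; apply: (bilinear_comp tb (tl _) (@anchor_linear _)).
Qed.

Lemma crossed_act_linear x : linear (crossed_act x).
Proof. exact/tlift_linear/crossed_act_bilin. Qed.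

Lemma crossed_actE p q x l a : homog p x -> homog q l ->
  crossed_act x (tens l a) = ksgn K p q *: tens l (lr_anchor E x a).
Proof.
move=> hx hl; rewrite /crossed_act tlift_tens; last exact: crossed_act_bilin.
rewrite !(twist_homog _ hl) !(spart_homog _ hx) !tensZl.
have [_ [al _ _] _ _] := lr_axioms E.
have a0 : lr_anchor E 0 a = 0 := lin_zero (al a).
by case: p hx => hx; rewrite /= a0 tens0r scaler0 ?add0r ?addr0.
Qed.

Lemma tensor_br_bilin1 l a : is_bilinear (fun (l' : g) (b : A) =>
  tens (sbr l (twist false l')) (smul (spart false a) b)
  + tens (sbr l (twist true l')) (smul (spart true a) b)).
Proof.
have [[_ brl] _] := @sbr_graded K g; have [[_ mul] _] := @smul_graded K A.
apply: bilinear_add.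
  exact: (bilinear_comp (tens_bilinear _ _)
           (linear_compose (brl l) (@twist_linear _ g false)) (mul (spart false a))).
exact: (bilinear_comp (tens_bilinear _ _)
         (linear_compose (brl l) (@twist_linear _ g true)) (mul (spart true a))).
Qed.

Lemma tensor_br_bilin2 t : is_bilinear (fun (l : g) (a : A) =>
  tlift (fun l' b => tens (sbr l (twist false l')) (smul (spart false a) b)
                     + tens (sbr l (twist true l')) (smul (spart true a) b)) t).
Proof.
have [[brr _] _] := @sbr_graded K g; have [[mur _] _] := @smul_graded K A.
split=> [a|l].
  apply: (tlift_linear_param (b := fun l l' b =>
    tens (sbr l (twist false l')) (smul (spart false a) b)
    + tens (sbr l (twist true l')) (smul (spart true a) b))) => [l|l' b].
    exact: tensor_br_bilin1.
  by move=> k x y; rewrite !brr !tensDl !tensZl scalerDr addrACA.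
apply: (tlift_linear_param (b := fun a l' b =>
  tens (sbr l (twist false l')) (smul (spart false a) b)
  + tens (sbr l (twist true l')) (smul (spart true a) b))) => [a|l' b].
  exact: tensor_br_bilin1.
by move=> k x y; rewrite !linearP /= !mur !tensDr !tensZr scalerDr addrACA.
Qed.

Lemma tensor_brE p q l a l' b : homog p a -> homog q l' ->
  tensor_br (tens l a) (tens l' b) = ksgn K p q *: tens (sbr l l') (smul a b).
Proof.
move=> ha hl'; rewrite /tensor_br tlift_tens; last exact: tensor_br_bilin2.
rewrite tlift_tens; last exact: tensor_br_bilin1.
have [[_ brl] _] := @sbr_graded K g; have [[mur _] _] := @smul_graded K A.
rewrite !(twist_homog _ hl') !(spart_homog _ ha) !(lin_scale (brl l)) !tensZl.
have m0 : smul 0 b = 0 := lin_zero (mur b).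
by case: p ha => ha; rewrite /= m0 tens0r scaler0 ?add0r ?addr0.
Qed.

Definition even_crossed_hom (H : L -> tensor g A) : Prop :=
  [/\ linear H, even_fun H
    & forall p q x y, homog p x -> homog q y ->
        H (sbr x y) = crossed_act x (H y) - ksgn K p q *: crossed_act y (H x)
                      + tensor_br (H x) (H y)].

End CrossedHom.

Section TensorMaps.
Variable K : fieldType.
Implicit Types U V W X : lmodType K.

Definition tmap U U' V V' (f : U -> U') (h : V -> V') :
  tensor U V -> tensor U' V' := tlift (fun u v => tens (f u) (h v)).

Let tmap_bilin U U' V V' (f : U -> U') (h : V -> V') :
  linear f -> linear h -> is_bilinear (fun u v => tens (f u) (h v)).
Proof. by move=> fl hl; exact: (bilinear_comp (tens_bilinear _ _) fl hl). Qed.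

Lemma tmap_linear U U' V V' (f : U -> U') (h : V -> V') :
  linear f -> linear h -> linear (tmap f h).
Proof. by move=> fl hl; apply: tlift_linear; apply: tmap_bilin. Qed.

Lemma tmapE U U' V V' (f : U -> U') (h : V -> V') u v :
  linear f -> linear h -> tmap f h (tens u v) = tens (f u) (h v).
Proof. by move=> fl hl; apply: tlift_tens; apply: tmap_bilin. Qed.

Lemma tens_lin_ext U V X (f h : tensor U V -> X) : linear f -> linear h ->
  (forall u v, f (tens u v) = h (tens u v)) -> f =1 h.
Proof. by move=> /lin_add fD /lin_add hD; apply: tens_ext. Qed.

Lemma tens3_lin_ext U V W X (f h : tensor (tensor U V) W -> X) :
  linear f -> linear h ->
  (forall u v w, f (tens (tens u v) w) = h (tens (tens u v) w)) -> f =1 h.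
Proof.
move=> fl hl e; apply: tens_lin_ext => // t w; move: t.
apply: (tens_lin_ext (f := fun t => f (tens t w)) (h := fun t => h (tens t w))) => //.
  by move=> k x y; rewrite ((tens_bilinear _ _).1 w) fl.
by move=> k x y; rewrite ((tens_bilinear _ _).1 w) hl.
Qed.

Lemma tens3r_lin_ext U V W X (f h : tensor U (tensor V W) -> X) :
  linear f -> linear h ->
  (forall u v w, f (tens u (tens v w)) = h (tens u (tens v w))) -> f =1 h.
Proof.
move=> fl hl e; apply: tens_lin_ext => // u t; move: t.
apply: (tens_lin_ext (f := fun t => f (tens u t)) (h := fun t => h (tens u t))) => //.
  by move=> k x y; rewrite ((tens_bilinear _ _).2 u) fl.
by move=> k x y; rewrite ((tens_bilinear _ _).2 u) hl.
Qed.

Lemma tmap_id U V : tmap (fun u : U => u) (fun v : V => v) =1 (fun t => t).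
Proof.
apply: tens_lin_ext => // [|u v]; first exact: tmap_linear.
exact: tmapE.
Qed.

Lemma tmap_comp U U' U'' V V' V'' (f' : U' -> U'') (f : U -> U')
    (h' : V' -> V'') (h : V -> V') :
  linear f' -> linear f -> linear h' -> linear h ->
  tmap (fun u => f' (f u)) (fun v => h' (h v)) =1 (fun t => tmap f' h' (tmap f h t)).
Proof.
move=> f'l fl h'l hl; have fcl := linear_compose f'l fl; have hcl := linear_compose h'l hl.
apply: tens_lin_ext => [||u v].
- exact: tmap_linear.
- by apply: linear_compose; apply: tmap_linear.
- by rewrite !tmapE.
Qed.

(* (u (x) v) (x) w |-> u (x) (v (x) w) *)
Definition assoc_fun U V W : tensor (tensor U V) W -> tensor U (tensor V W) :=
  tlift (fun t w => tlift (fun u v => tens u (tens v w)) t).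

Let assoc_bilin0 U V W (w : W) : is_bilinear (fun (u : U) (v : V) => tens u (tens v w)).
Proof.
exact: (bilinear_comp (tens_bilinear _ _) (@linear_idfun _ _) ((tens_bilinear _ _).1 w)).
Qed.

Let assoc_bilin U V W : is_bilinear (fun (t : tensor U V) (w : W) =>
  tlift (fun u v => tens u (tens v w)) t).
Proof.
split=> [w|]; first exact/tlift_linear/assoc_bilin0.
apply: (tlift_linear_param (b := fun w u v => tens u (tens v w))).
  exact: assoc_bilin0.
by move=> u v k x y; rewrite !tensDr !tensZr.
Qed.

Lemma assoc_linear U V W : linear (@assoc_fun U V W).
Proof. exact/tlift_linear/assoc_bilin. Qed.

Lemma assocE U V W (u : U) (v : V) (w : W) :
  assoc_fun (tens (tens u v) w) = tens u (tens v w).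
Proof.
by rewrite /assoc_fun tlift_tens ?tlift_tens //.
Qed.

Definition associ_fun U V W : tensor U (tensor V W) -> tensor (tensor U V) W :=
  tlift (fun u t => tlift (fun v w => tens (tens u v) w) t).

Let associ_bilin0 U V W (u : U) : is_bilinear (fun (v : V) (w : W) => tens (tens u v) w).
Proof.
exact: (bilinear_comp (tens_bilinear _ _) ((tens_bilinear _ _).2 u) (@linear_idfun _ _)).
Qed.

Let associ_bilin U V W : is_bilinear (fun (u : U) (t : tensor V W) =>
  tlift (fun v w => tens (tens u v) w) t).
Proof.
split=> [|u]; last exact/tlift_linear/associ_bilin0.
apply: (tlift_linear_param (b := fun u v w => tens (tens u v) w)).
  exact: associ_bilin0.
by move=> u v k x y; rewrite !tensDl !tensZl.
Qed.

Lemma associ_linear U V W : linear (@associ_fun U V W).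
Proof. exact/tlift_linear/associ_bilin. Qed.

Lemma associE U V W (u : U) (v : V) (w : W) :
  associ_fun (tens u (tens v w)) = tens (tens u v) w.
Proof.
by rewrite /associ_fun tlift_tens ?tlift_tens //.
Qed.

Lemma assocK U V W : cancel (@assoc_fun U V W) (@associ_fun U V W).
Proof.
apply: (tens3_lin_ext (f := fun t => associ_fun (assoc_fun t)) (h := fun t => t)) => //.
  exact: linear_compose (@associ_linear _ _ _) (@assoc_linear _ _ _).
by move=> u v w; rewrite assocE associE.
Qed.

Lemma associK U V W : cancel (@associ_fun U V W) (@assoc_fun U V W).
Proof.
apply: (tens3r_lin_ext (f := fun t => assoc_fun (associ_fun t)) (h := fun t => t)) => //.
  exact: linear_compose (@assoc_linear _ _ _) (@associ_linear _ _ _).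
by move=> u v w; rewrite associE assocE.
Qed.

Lemma assoc_nat U U' V V' W W' (f : U -> U') (h : V -> V') (k : W -> W') :
  linear f -> linear h -> linear k ->
  (fun t => assoc_fun (tmap (tmap f h) k t)) =1
  (fun t => tmap f (tmap h k) (assoc_fun t)).
Proof.
move=> fl hl kl; have fhl := tmap_linear fl hl; have hkl := tmap_linear hl kl.
apply: tens3_lin_ext => [||u v w].
- exact: linear_compose (@assoc_linear _ _ _) (tmap_linear fhl kl).
- exact: linear_compose (tmap_linear fl hkl) (@assoc_linear _ _ _).
- by rewrite assocE !tmapE // assocE.
Qed.

Lemma assoc_pentagon U V W X :
  (fun t => tmap (fun u : U => u) (@assoc_fun V W X)
     (assoc_fun (tmap (@assoc_fun U V W) (fun x : X => x) t))) =1
  (fun t => assoc_fun (assoc_fun t)).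
Proof.
have al := @assoc_linear; have il := @linear_idfun K.
set f := (fun t => tmap _ _ _); set h := (fun t => assoc_fun _).
have fl : linear f.
  apply: linear_compose (tmap_linear (il U) (@al V W X)) _.
  exact: linear_compose (@al _ _ _) (tmap_linear (@al _ _ _) (il _)).
have hl : linear h by exact: linear_compose (@al _ _ _) (@al _ _ _).
apply: (tens3_lin_ext fl hl) => t w x; move: t.
pose j (t : tensor U V) := tens (tens t w) x.
have jl : linear j.
  exact: (@linear_compose _ _ _ _ (fun t => tens t x) _ ((tens_bilinear _ _).1 x) ((tens_bilinear _ _).1 w)).
apply: (tens_lin_ext (linear_compose fl jl) (linear_compose hl jl)) => u v.
rewrite /f /h /j tmapE //; try exact: al.
by rewrite !assocE tmapE ?assocE //; exact: al.
Qed.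

Definition left_fun V : tensor K^o V -> V := tlift (fun (c : K^o) v => (c : K) *: v).
Definition right_fun V : tensor V K^o -> V := tlift (fun v (c : K^o) => (c : K) *: v).

Let left_bilin V : is_bilinear (fun (c : K^o) (v : V) => (c : K) *: v).
Proof.
split=> [v k x y|c k x y]; first by rewrite scalerDl -scalerA.
by rewrite scalerDr !scalerA mulrC.
Qed.

Let right_bilin V : is_bilinear (fun (v : V) (c : K^o) => (c : K) *: v).
Proof. by have [l r] := left_bilin V; split. Qed.

Lemma left_linear V : linear (@left_fun V).
Proof. exact/tlift_linear/left_bilin. Qed.
Lemma right_linear V : linear (@right_fun V).
Proof. exact/tlift_linear/right_bilin. Qed.
Lemma leftE V (c : K^o) (v : V) : left_fun (tens c v) = (c : K) *: v.
Proof. exact/tlift_tens/left_bilin. Qed.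
Lemma rightE V (c : K^o) (v : V) : right_fun (tens v c) = (c : K) *: v.
Proof. exact/tlift_tens/right_bilin. Qed.

Lemma leftVK V : cancel (tens (1 : K^o)) (@left_fun V).
Proof. by move=> v; rewrite leftE scale1r. Qed.
Lemma rightVK V : cancel (fun v => tens v (1 : K^o)) (@right_fun V).
Proof. by move=> v; rewrite rightE scale1r. Qed.

Lemma leftK V : cancel (@left_fun V) (tens (1 : K^o)).
Proof.
apply: (tens_lin_ext (f := fun t => tens (1 : K^o) (left_fun t)) (h := fun t => t)) => //.
  exact: linear_compose ((tens_bilinear _ _).2 _) (@left_linear _).
by move=> c v; rewrite leftE tensZr -tensZl; congr tens; apply: mulr1.
Qed.

Lemma rightK V : cancel (@right_fun V) (fun v => tens v (1 : K^o)).
Proof.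
apply: (tens_lin_ext (f := fun t => tens (right_fun t) (1 : K^o)) (h := fun t => t)) => //.
  exact: (@linear_compose _ _ _ _ (fun v => tens v _) _ ((tens_bilinear _ _).1 _) (@right_linear _)).
by move=> v c; rewrite rightE tensZl -tensZr; congr tens; apply: mulr1.
Qed.

Lemma left_nat V V' (f : V -> V') : linear f ->
  (fun t => left_fun (tmap (fun c : K^o => c) f t)) =1 (fun t => f (left_fun t)).
Proof.
move=> fl; apply: tens_lin_ext => [||c v].
- exact: linear_compose (@left_linear _) (tmap_linear (@linear_idfun _ _) fl).
- exact: linear_compose fl (@left_linear _).
- by rewrite tmapE // !leftE (lin_scale fl).
Qed.

Lemma right_nat V V' (f : V -> V') : linear f ->
  (fun t => right_fun (tmap f (fun c : K^o => c) t)) =1 (fun t => f (right_fun t)).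
Proof.
move=> fl; apply: tens_lin_ext => [||c v].
- exact: linear_compose (@right_linear _) (tmap_linear fl (@linear_idfun _ _)).
- exact: linear_compose fl (@right_linear _).
- by rewrite tmapE // !rightE (lin_scale fl).
Qed.

Lemma assoc_triangle U V :
  (fun t => tmap (fun u : U => u) (@left_fun V) (assoc_fun t)) =1
  tmap (@right_fun U) (fun v : V => v).
Proof.
have il := @linear_idfun K; have ll := @left_linear; have rl := @right_linear.
apply: tens3_lin_ext => [||u c v].
- exact: linear_compose (tmap_linear (il U) (ll V)) (@assoc_linear _ _ _).
- exact: tmap_linear (rl U) (il V).
- rewrite assocE tmapE //; last exact: ll.
  by rewrite tmapE // ?leftE ?rightE ?tensZr ?tensZl //; exact: rl.
Qed.
End TensorMaps.

Record category := Category {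
  ob :> Type;
  hom : ob -> ob -> Type;
  idc : forall X, hom X X;
  comp : forall X Y Z, hom Y Z -> hom X Y -> hom X Z;
  comp_idl : forall X Y (f : hom X Y), comp (idc Y) f = f;
  comp_idr : forall X Y (f : hom X Y), comp f (idc X) = f;
  comp_assoc : forall X Y Z T (f : hom Z T) (g : hom Y Z) (h : hom X Y),
    comp f (comp g h) = comp (comp f g) h }.

Arguments idc {c} X.
Notation "f '\oc' g" := (comp f g) (at level 50, left associativity).

Definition is_iso (C : category) (X Y : C) (f : hom X Y) : Prop :=
  exists g : hom Y X, g \oc f = idc X /\ f \oc g = idc Y.

(* A bifunctor C * D -> E with object map F. *)
Record bifunctor_on (C D E : category) (F : C -> D -> E) := Bifunctor {
  bimap : forall X X' Y Y', hom X X' -> hom Y Y' -> hom (F X Y) (F X' Y');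
  bimap_id : forall X Y, bimap (idc X) (idc Y) = idc (F X Y);
  bimap_comp : forall X X' X'' Y Y' Y'' (f' : hom X' X'') (f : hom X X')
      (g' : hom Y' Y'') (g : hom Y Y'),
    bimap (f' \oc f) (g' \oc g) = bimap f' g' \oc bimap f g }.

Record monoidal_category := MonoidalCategory {
  mc_cat :> category;
  mc_tensor : mc_cat -> mc_cat -> mc_cat;
  mc_bifun : bifunctor_on mc_tensor;
  mc_unit : mc_cat;
  mc_assoc : forall U V W,
    hom (mc_tensor (mc_tensor U V) W) (mc_tensor U (mc_tensor V W));
  mc_left : forall V, hom (mc_tensor mc_unit V) V;
  mc_right : forall V, hom (mc_tensor V mc_unit) V;
  mc_assoc_iso : forall U V W, is_iso (mc_assoc U V W);
  mc_left_iso : forall V, is_iso (mc_left V);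
  mc_right_iso : forall V, is_iso (mc_right V);
  mc_assoc_nat : forall U U' V V' W W'
      (f : hom U U') (g : hom V V') (h : hom W W'),
    mc_assoc U' V' W' \oc bimap mc_bifun (bimap mc_bifun f g) h =
    bimap mc_bifun f (bimap mc_bifun g h) \oc mc_assoc U V W;
  mc_left_nat : forall V V' (f : hom V V'),
    mc_left V' \oc bimap mc_bifun (idc mc_unit) f = f \oc mc_left V;
  mc_right_nat : forall V V' (f : hom V V'),
    mc_right V' \oc bimap mc_bifun f (idc mc_unit) = f \oc mc_right V;
  mc_pentagon : forall U V W X,
    bimap mc_bifun (idc U) (mc_assoc V W X) \oc mc_assoc U (mc_tensor V W) X
      \oc bimap mc_bifun (mc_assoc U V W) (idc X) =
    mc_assoc U V (mc_tensor W X) \oc mc_assoc (mc_tensor U V) W X;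
  mc_triangle : forall U V,
    bimap mc_bifun (idc U) (mc_left V) \oc mc_assoc U mc_unit V =
    bimap mc_bifun (mc_right U) (idc V) }.

(* A left D-module category structure on M whose action on objects is F. *)
Record module_category_on (D : monoidal_category) (M : category)
    (F : D -> M -> M) := ModuleCategory {
  mod_bifun : bifunctor_on F;
  mod_assoc : forall U V Z, hom (F (mc_tensor U V) Z) (F U (F V Z));
  mod_unit : forall Z, hom (F (mc_unit D) Z) Z;
  mod_assoc_iso : forall U V Z, is_iso (mod_assoc U V Z);
  mod_unit_iso : forall Z, is_iso (mod_unit Z);
  mod_assoc_nat : forall U U' V V' Z Z'
      (f : hom U U') (g : hom V V') (h : hom Z Z'),
    mod_assoc U' V' Z' \oc bimap mod_bifun (bimap (mc_bifun D) f g) h =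
    bimap mod_bifun f (bimap mod_bifun g h) \oc mod_assoc U V Z;
  mod_unit_nat : forall Z Z' (f : hom Z Z'),
    mod_unit Z' \oc bimap mod_bifun (idc (mc_unit D)) f = f \oc mod_unit Z;
  mod_pentagon : forall U V W Z,
    bimap mod_bifun (idc U) (mod_assoc V W Z) \oc mod_assoc U (mc_tensor V W) Z
      \oc bimap mod_bifun (mc_assoc U V W) (idc Z) =
    mod_assoc U V (F W Z) \oc mod_assoc (mc_tensor U V) W Z;
  mod_triangle : forall U Z,
    bimap mod_bifun (idc U) (mod_unit Z) \oc mod_assoc U (mc_unit D) Z =
    bimap mod_bifun (mc_right U) (idc Z) }.

Section WModCategory.
Variables (K : fieldType) (A : superComAlgType K) (L : lieSuperType K).
Variable E : lie_rinehart A L.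

Lemma weak_rep_hom_eq (M N : weak_rep E) (f g : weak_rep_hom M N) : f =1 g -> f = g.
Proof.
case: f g => [f f1 f2 f3 f4] [h h1 h2 h3 h4] /= /funext e.
by case: _ / e in h1 h2 h3 h4 *; congr WeakRepHom; apply: Prop_irrelevance.
Qed.

Definition wid (M : weak_rep E) : weak_rep_hom M M :=
  @WeakRepHom _ _ _ _ M M (fun m => m) (@linear_idfun _ _) (fun _ _ h => h)
    (fun _ _ => erefl) (fun _ _ => erefl).

Definition wcomp (M N P : weak_rep E) (f : weak_rep_hom N P)
    (h : weak_rep_hom M N) : weak_rep_hom M P.
Proof.
apply: (@WeakRepHom _ _ _ _ M P (fun m => f (h m))).
- exact: linear_compose (wr_fun_linear f) (wr_fun_linear h).
- by move=> p v /(wr_fun_even h) /(wr_fun_even f).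
- by move=> a m; rewrite !wr_fun_actA.
- by move=> x m; rewrite !wr_fun_actL.
Defined.

Definition WMod : category.
Proof.
apply: (@Category (weak_rep E) (@weak_rep_hom K A L E) wid wcomp);
  by move=> *; apply: weak_rep_hom_eq.
Defined.
End WModCategory.

Lemma addr_cancel6 (V : zmodType) (t1 t2 t3 t4 t5 t6 : V) :
  t1 - t2 + (t3 - t4) = t1 + t5 + (t6 + t3) + (- t2 - t6 + (- t5 - t4)).
Proof.
rewrite [t6 + t3]addrC [t1 + t5 + _]addrACA [- t5 - t4]addrC.
rewrite [- t2 - t6 + _]addrACA -[- t6 - t5]opprD [t6 + t5]addrC.
by rewrite [RHS]addrACA subrr addr0 [RHS]addrACA.
Qed.

Section ModCategory.
Variables (K : fieldType) (g : lieSuperType K).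
Implicit Types U V W X : lie_module g.

Lemma lie_module_hom_eq V W (f h : lie_module_hom V W) : f =1 h -> f = h.
Proof.
case: f h => [f f1 f2 f3] [h h1 h2 h3] /= /funext e.
by case: _ / e in h1 h2 h3 *; congr LieModuleHom; apply: Prop_irrelevance.
Qed.

Definition lmid V : lie_module_hom V V :=
  @LieModuleHom _ _ V V (fun m => m) (@linear_idfun _ _) (fun _ _ h => h)
    (fun _ _ => erefl).

Definition lmcomp U V W (f : lie_module_hom V W) (h : lie_module_hom U V) :
  lie_module_hom U W.
Proof.
apply: (@LieModuleHom _ _ U W (fun m => f (h m))).
- exact: linear_compose (lm_fun_linear f) (lm_fun_linear h).
- by move=> p v /(lm_fun_even h) /(lm_fun_even f).
- by move=> a m; rewrite !lm_fun_act.
Defined.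

Definition Mod_cat : category.
Proof.
apply: (@Category (lie_module g) (@lie_module_hom K g) lmid lmcomp);
  by move=> *; apply: lie_module_hom_eq.
Defined.

Lemma lm_actl V (x : g) : linear (@lm_act _ _ V x).
Proof. by have [[[_ h] _] _] := @lm_axioms _ _ V; apply: h. Qed.
Lemma lm_actr V (v : V) : linear (fun x => lm_act x v).
Proof. by have [[[h _] _] _] := @lm_axioms _ _ V; apply: h. Qed.
Lemma lm_act_graded V p q (x : g) (v : V) :
  homog p x -> homog q v -> homog (p (+) q) (lm_act x v).
Proof. by have [[_ h] _] := @lm_axioms _ _ V; apply: h. Qed.
Lemma lm_act_br V p q (x y : g) (v : V) : homog p x -> homog q y ->
  lm_act (sbr x y) v = lm_act x (lm_act y v) - ksgn K p q *: lm_act y (lm_act x v).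
Proof. by have [_ h] := @lm_axioms _ _ V; apply: h. Qed.

(* x (v (x) w) = x v (x) w + (-1)^(|x||v|) v (x) x w *)
Definition tensor_act V W (x : g) : tensor V W -> tensor V W :=
  tlift (fun v w => tens (lm_act x v) w
                    + (tens (twist false v) (lm_act (spart false x) w)
                       + tens (twist true v) (lm_act (spart true x) w))).

Lemma tensor_act_bilin V W (x : g) : is_bilinear (fun (v : V) (w : W) =>
  tens (lm_act x v) w + (tens (twist false v) (lm_act (spart false x) w)
                         + tens (twist true v) (lm_act (spart true x) w))).
Proof.
have tb := tens_bilinear V W; have tl := @twist_linear K V.
apply: bilinear_add; last apply: bilinear_add.
- exact: (bilinear_comp tb (@lm_actl V x) (@linear_idfun _ _)).
- exact: (bilinear_comp tb (tl _) (@lm_actl W _)).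
- exact: (bilinear_comp tb (tl _) (@lm_actl W _)).
Qed.

Lemma tensor_act_linear V W x : linear (@tensor_act V W x).
Proof. exact/tlift_linear/tensor_act_bilin. Qed.

Lemma tensor_actE V W p q (x : g) (v : V) (w : W) : homog p x -> homog q v ->
  tensor_act x (tens v w) =
    tens (lm_act x v) w + ksgn K p q *: tens v (lm_act x w).
Proof.
move=> hx hv; rewrite /tensor_act tlift_tens; last exact: tensor_act_bilin.
congr (_ + _); rewrite !(twist_homog _ hv) !(spart_homog _ hx) !tensZl.
have a0 : lm_act 0 w = 0 := lin_zero (lm_actr w).
by case: p hx => hx; rewrite /= a0 tens0r scaler0 ?add0r ?addr0.
Qed.

Lemma tensor_act_axioms V W : is_graded_Lmodule (@tensor_act V W).
Proof.
split; first split; first split=> [t|x].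
- apply: (tlift_linear_param (b := fun x (v : V) (w : W) =>
    tens (lm_act x v) w + (tens (twist false v) (lm_act (spart false x) w)
                         + tens (twist true v) (lm_act (spart true x) w)))).
    exact: tensor_act_bilin.
  move=> v w; apply: linear_plus; last apply: linear_plus.
  + exact: (@linear_compose _ _ _ _ (fun u => tens u w) _ ((tens_bilinear _ _).1 w) (lm_actr v)).
  + apply: (@linear_compose _ _ _ _ (tens _) _ ((tens_bilinear _ _).2 _)).
    exact: (@linear_compose _ _ _ _ (fun x => lm_act x w) _ (lm_actr w) (spart_linear _)).
  + apply: (@linear_compose _ _ _ _ (tens _) _ ((tens_bilinear _ _).2 _)).
    exact: (@linear_compose _ _ _ _ (fun x => lm_act x w) _ (lm_actr w) (spart_linear _)).
- exact: tensor_act_linear.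
- move=> p q x t hx; move: q t; apply: tensor_graded; first exact: tensor_act_linear.
  move=> q r v w hv hw; rewrite (tensor_actE _ hx hv); apply: homogD.
    by rewrite addbA; apply: homog_tens => //; apply: lm_act_graded.
  apply: homogZ; rewrite addbCA; apply: homog_tens => //; exact: lm_act_graded.
- move=> p q x y t hx hy; have ad z := lin_add (@tensor_act_linear V W z).
  have sc z := lin_scale (@tensor_act_linear V W z).
  move: t; apply: tens_ext_homog => [s t|s t|r s v w hv hw]; first exact: ad.
    by rewrite !ad scalerDr opprD addrACA.
  have hxy : homog (p (+) q) (sbr x y) by have [_ h] := @sbr_graded K g; apply: h.
  rewrite (tensor_actE _ hxy hv) (tensor_actE _ hx hv) (tensor_actE _ hy hv) !ad !sc.
  rewrite (tensor_actE _ hx (lm_act_graded hy hv)) (tensor_actE _ hx hv).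
  rewrite (tensor_actE _ hy (lm_act_graded hx hv)) (tensor_actE _ hy hv).
  rewrite !(lm_act_br _ hx hy) -scaleN1r !tensDl !tensDr !scaleNr !scale1r.
  rewrite -!scaleNr !tensZl !tensZr.
  rewrite !scalerDr !scalerA [ksgn K p (_ (+) _)]ksgnC [ksgn K q (_ (+) _)]ksgnC.
  rewrite !ksgn_add [ksgn K q p]ksgnC [ksgn K r p]ksgnC [ksgn K r q]ksgnC.
  have e := ksgn_sqr K p q.
  set a := ksgn K p q in e *; set b := ksgn K p r; set c := ksgn K q r.
  rewrite !mulNr !mulrN !scaleNr.
  by rewrite mulrA e mul1r [c * b]mulrC [b * c * a]mulrC mulrA; apply: addr_cancel6.
Qed.

Definition lm_tensor V W : lie_module g := LieModule (tensor_act_axioms V W).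

Fact triv_axioms : is_graded_Lmodule (fun (_ : g) (_ : K^o) => 0 : K^o).
Proof.
split; last by move=> *; rewrite scaler0 subr0.
split; last by move=> p q x v _ _; rewrite /homog linear0.
by split=> ? k u v; rewrite scaler0 addr0.
Qed.

Definition lm_triv : lie_module g := LieModule triv_axioms.

Section TensorHom.
Variables (U V X : lie_module g) (f : tensor U V -> X).
Hypothesis fl : linear f.
Hypothesis fg : forall p q u v, homog p u -> homog q v ->
  homog (p (+) q) (f (tens u v)).
Hypothesis fa : forall p q r x u v, homog p x -> homog q u -> homog r v ->
  f (tensor_act x (tens u v)) = lm_act x (f (tens u v)).

Lemma tensor_hom_act (x : g) t : f (tensor_act x t) = lm_act x (f t).
Proof.
have ad z := lin_add (@tensor_act_linear U V z).
have al z := lin_add (@lm_actl X z); have fD := lin_add fl.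
move: t; apply: tens_ext_homog => [s t|s t|q r u v hu hv].
- by rewrite ad fD.
- by rewrite fD al.
have [[[tr _] _] _] := tensor_act_axioms U V.
rewrite -[x]spart_sum (lin_add (tr _)) fD (lin_add (@lm_actr X _)).
by rewrite !(fa (homog_spart _ _) hu hv).
Qed.

Definition tensor_hom : lie_module_hom (lm_tensor U V) X :=
  @LieModuleHom _ _ (lm_tensor U V) X f fl (tensor_graded (r := false) fl fg)
    tensor_hom_act.
End TensorHom.

Lemma lm_iso U V (f : lie_module_hom U V) (h : V -> U) : linear h ->
  cancel f h -> cancel h f -> @is_iso Mod_cat U V f.
Proof.
move=> hl fK hK.
have he : even_fun h.
  move=> p w hw; rewrite /homog -[LHS]fK -[RHS]fK; congr h; rewrite hK -[RHS]hw -{2}[w]hK.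
  move: (h w) => u; have fD := lin_add (lm_fun_linear f).
  have fu q := lm_fun_even f (homog_spart q u).
  rewrite -{2}[u](spart_sumb p) fD linearD /= (fu p) (spart_homog p (fu (~~ p))).
  by case: (p) => /=; rewrite addr0.
have ha x w : h (lm_act x w) = lm_act x (h w).
  by rewrite -{1}[w]hK -lm_fun_act fK.
by exists (LieModuleHom hl he ha); split; apply: lie_module_hom_eq.
Qed.

Section TensorBimap.
Variables (U U' V V' : lie_module g).
Variables (f : lie_module_hom U U') (h : lie_module_hom V V').
Let fl := lm_fun_linear f.
Let hl := lm_fun_linear h.

Fact tensor_bimap_graded p q u v : homog p u -> homog q v ->
  homog (p (+) q) (tmap f h (tens u v)).
Proof. by move=> hu hv; rewrite tmapE //; apply: homog_tens; apply: lm_fun_even. Qed.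

Fact tensor_bimap_act p q r (x : g) u v : homog p x -> homog q u -> homog r v ->
  tmap f h (tensor_act x (tens u v)) =
  @lm_act _ _ (lm_tensor U' V') x (tmap f h (tens u v)).
Proof.
move=> hx hu hv; rewrite (tensor_actE _ hx hu) (lin_add (tmap_linear fl hl)).
rewrite (lin_scale (tmap_linear fl hl)) !tmapE // !lm_fun_act.
by rewrite [RHS](tensor_actE _ hx (lm_fun_even f hu)).
Qed.

Definition tensor_bimap : lie_module_hom (lm_tensor U V) (lm_tensor U' V') :=
  @tensor_hom U V (lm_tensor U' V') (tmap f h) (tmap_linear fl hl)
    tensor_bimap_graded tensor_bimap_act.
End TensorBimap.

Lemma assoc_graded (U V W : superType K) p q (t : tensor U V) (w : W) :
  homog p t -> homog q w -> homog (p (+) q) (assoc_fun (tens t w)).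
Proof.
have aD := lin_add (@assoc_linear K U V W); have aZ := lin_scale (@assoc_linear K U V W).
move=> ht hw; move: p t ht.
have h := tensor_graded (r := q) (f := fun t : tensor U V => assoc_fun (tens t w)).
move=> p t ht; rewrite addbC; apply: h ht => [|r s u v hu hv].
  by move=> k x y; rewrite tensDl tensZl aD aZ.
by rewrite assocE addbC -addbA; do 2?apply: homog_tens.
Qed.

Fact tensor_assoc_act U V W p q r (x : g) (t : tensor U V) (w : W) :
  homog p x -> homog q t -> homog r w ->
  assoc_fun (@tensor_act (lm_tensor U V) W x (tens t w)) =
  @lm_act _ _ (lm_tensor U (lm_tensor V W)) x (assoc_fun (tens t w)).
Proof.
have aD := lin_add (@assoc_linear K U V W); have aZ := lin_scale (@assoc_linear K U V W).
move=> hx ht hw; rewrite -ht; move: t {ht}.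
have sD := lin_add (@spart_linear K (tensor U V) q).
have tD := lin_add (@tensor_act_linear (lm_tensor U V) W x).
have tD' := lin_add (@tensor_act_linear U (lm_tensor V W) x).
apply: tens_ext_homog => [s t|s t|s s' u v hu hv].
- by rewrite sD tensDl tD aD.
- by rewrite sD tensDl aD; apply: tD'.
have huv := homog_tens hu hv; rewrite (spart_homog _ huv).
case: eqP => _; last first.
  by rewrite tens0l (lin_zero (@tensor_act_linear _ _ x)) (lin_zero (@assoc_linear K U V W))
    (lin_zero (@lm_actl _ x)).
rewrite (@tensor_actE (lm_tensor U V) W _ _ x _ w hx huv) aD aZ.
rewrite [@lm_act _ _ (lm_tensor U V) x _](tensor_actE _ hx hu).
rewrite tensDl tensZl aD aZ !assocE.
rewrite [RHS](@tensor_actE U (lm_tensor V W) _ _ x _ _ hx hu).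
rewrite [@lm_act _ _ (lm_tensor V W) x _](tensor_actE _ hx hv).
rewrite tensDr tensZr scalerDr scalerA.
by rewrite addrA [ksgn K p (_ (+) _)]ksgnC ksgn_add ![ksgn K _ p]ksgnC.
Qed.

Definition tensor_assoc U V W :
    lie_module_hom (lm_tensor (lm_tensor U V) W) (lm_tensor U (lm_tensor V W)) :=
  @tensor_hom (lm_tensor U V) W (lm_tensor U (lm_tensor V W)) (@assoc_fun K U V W)
    (@assoc_linear K U V W) (@assoc_graded U V W) (@tensor_assoc_act U V W).

Lemma left_graded (V : superType K) p q (c : K^o) (v : V) :
  homog p c -> homog q v -> homog (p (+) q) (left_fun (tens c v)).
Proof.
move=> hc hv; rewrite leftE; case: p hc => hc; last exact: homogZ.
by rewrite /homog -hc /= scale0r linear0.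
Qed.

Fact tensor_left_act V p q r (x : g) (c : K^o) (v : V) :
  homog p x -> homog q c -> homog r v ->
  left_fun (@tensor_act lm_triv V x (tens c v)) = lm_act x (left_fun (tens c v)).
Proof.
move=> hx hc hv; rewrite (@tensor_actE lm_triv V _ _ x c v hx hc) tens0l add0r.
rewrite (lin_scale (@left_linear K V)) !leftE (lin_scale (@lm_actl V x)).
case: q hc => hc; last by rewrite /ksgn andbF scale1r.
by rewrite -hc /= !scale0r scaler0.
Qed.

Definition tensor_left V : lie_module_hom (lm_tensor lm_triv V) V :=
  @tensor_hom lm_triv V V (@left_fun K V) (@left_linear K V) (@left_graded V)
    (@tensor_left_act V).

Fact tensor_right_graded V p q (v : V) (c : K^o) :
  homog p v -> homog q c -> homog (p (+) q) (right_fun (tens v c)).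
Proof.
move=> hv hc; rewrite rightE; case: q hc => hc; last by rewrite addbF; apply: homogZ.
by rewrite /homog -hc /= scale0r linear0.
Qed.

Fact tensor_right_act V p q r (x : g) (v : V) (c : K^o) :
  homog p x -> homog q v -> homog r c ->
  right_fun (@tensor_act V lm_triv x (tens v c)) = lm_act x (right_fun (tens v c)).
Proof.
move=> hx hv hc; rewrite (@tensor_actE V lm_triv _ _ x v c hx hv) tens0r scaler0 addr0.
by rewrite !rightE (lin_scale (@lm_actl V x)).
Qed.

Definition tensor_right V : lie_module_hom (lm_tensor V lm_triv) V :=
  @tensor_hom V lm_triv V (@right_fun K V) (@right_linear K V)
    (@tensor_right_graded V) (@tensor_right_act V).

Fact Mod_bimap_id U V : tensor_bimap (lmid U) (lmid V) = lmid (lm_tensor U V).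
Proof. by apply: lie_module_hom_eq => t; exact: (@tmap_id K U V t). Qed.

Fact Mod_bimap_comp U U' U'' V V' V'' (f' : lie_module_hom U' U'')
    (f : lie_module_hom U U') (h' : lie_module_hom V' V'') (h : lie_module_hom V V') :
  tensor_bimap (lmcomp f' f) (lmcomp h' h) =
  lmcomp (tensor_bimap f' h') (tensor_bimap f h).
Proof.
apply: lie_module_hom_eq => t.
exact: (tmap_comp (lm_fun_linear f') (lm_fun_linear f) (lm_fun_linear h')
  (lm_fun_linear h)).
Qed.

Definition Mod_bifun : @bifunctor_on Mod_cat Mod_cat Mod_cat lm_tensor :=
  @Bifunctor Mod_cat Mod_cat Mod_cat lm_tensor tensor_bimap Mod_bimap_id
    Mod_bimap_comp.

Definition Mod : monoidal_category.
Proof.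
apply: (@MonoidalCategory Mod_cat lm_tensor Mod_bifun lm_triv tensor_assoc
  tensor_left tensor_right).
- move=> U V W; apply: (@lm_iso _ _ (tensor_assoc U V W) (@associ_fun K U V W)).
  + exact: associ_linear.
  + exact: assocK.
  + exact: associK.
- move=> V; apply: (@lm_iso _ _ (tensor_left V) (tens (1 : K^o))).
  + exact: (tens_bilinear _ _).2.
  + exact: leftK.
  + exact: leftVK.
- move=> V; apply: (@lm_iso _ _ (tensor_right V) (fun v => tens v (1 : K^o))).
  + exact: (tens_bilinear _ _).1.
  + exact: rightK.
  + exact: rightVK.
- move=> U U' V V' W W' f h k; apply: lie_module_hom_eq => t.
  exact: (assoc_nat (lm_fun_linear f) (lm_fun_linear h) (lm_fun_linear k) t).
- move=> V V' f; apply: lie_module_hom_eq => t.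
  exact: (left_nat (lm_fun_linear f) t).
- move=> V V' f; apply: lie_module_hom_eq => t.
  exact: (right_nat (lm_fun_linear f) t).
- by move=> U V W X; apply: lie_module_hom_eq => t; exact: assoc_pentagon t.
- by move=> U V; apply: lie_module_hom_eq => t; exact: assoc_triangle t.
Defined.
End ModCategory.

(* Main.v *)
Require Import Defs.
From mathcomp Require Import all_boot all_order all_algebra.
From mathcomp Require Import boolp reals complex.

Set Implicit Arguments.
Unset Strict Implicit.
Unset Printing Implicit Defensive.

Import GRing.Theory.
Local Open Scope ring_scope.

(* For a weak representation M, the Lie superalgebra g (x) A acts on V (x) M by
   rho(l (x) b) = (l (x) 1) o (1 (x) b), and L acts by sigma(x) = 1 (x) x.  These
   operators satisfy [sigma(x), rho(s)] = rho(x * s), so the crossed homomorphism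
   identity for H says exactly that sigma + rho o H is an action of L.  On
   (U (x) V) (x) M, comparing the two bracketings amounts to l acting on U (x) V
   through its coproduct. *)

(** * Sign twists and reduction to homogeneous vectors *)

Section SuperLinear.
Variable K : fieldType.

Lemma lin_opp (V W : lmodType K) (f : V -> W) : linear f -> {morph f : x / - x}.
Proof. by move=> fl x; rewrite -!scaleN1r (lin_scale fl). Qed.

Lemma twistD (V : superType K) p : {morph @twist K V p : v w / v + w}.
Proof. exact: (lin_add (@twist_linear K V p)). Qed.

Lemma twistZ (V : superType K) p k : {morph @twist K V p : v / k *: v}.
Proof. exact: (lin_scale (@twist_linear K V p)). Qed.

(** Koszul sign rules are available for homogeneous arguments; additivity carries them to every
    vector, which is the sum of its two parts. *)
Lemma spart_ext (V : superType K) (U : zmodType) (f h : V -> U) :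
  {morph f : x y / x + y} -> {morph h : x y / x + y} ->
  (forall p v, homog p v -> f v = h v) -> f =1 h.
Proof.
move=> fD hD e v.
by rewrite -(spart_sum v) fD hD !(e _ _ (homog_spart _ _)).
Qed.

Lemma twist_add (V : superType K) p q (v : V) :
  twist p (twist q v) = twist (p (+) q) v.
Proof.
move: v; apply: spart_ext => [v w|v w|r v hv].
- by rewrite !twistD.
- by rewrite twistD.
by rewrite !(twist_homog _ hv) twistZ (twist_homog _ hv) scalerA mulrC ksgn_add.
Qed.

Lemma twist_even (V W : superType K) (f : V -> W) p (v : V) :
  linear f -> even_fun f -> f (twist p v) = twist p (f v).
Proof.
move=> fl fe; have fD := lin_add fl.
move: v; apply: spart_ext => [v w|v w|r v hv].
- by rewrite twistD fD.
- by rewrite fD twistD.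
by rewrite (twist_homog _ hv) (twist_homog _ (fe _ _ hv)) (lin_scale fl).
Qed.

(** The signs (-1)^(p|u|) and (-1)^(p|v|) multiply to (-1)^(p(|u|+|v|)). This lets twists pass
    through rebracketing. *)
Lemma twist_tens (U V : superType K) p (u : U) (v : V) :
  twist p (tens u v) = tens (twist p u) (twist p v).
Proof.
move: u; apply: spart_ext => [u u'|u u'|q u hu].
- by rewrite tensDl twistD.
- by rewrite twistD tensDl.
move: v; apply: spart_ext => [v v'|v v'|r v hv].
- by rewrite tensDr twistD.
- by rewrite twistD tensDr.
rewrite (twist_homog _ hu) (twist_homog _ hv) (twist_homog _ (homog_tens hu hv)).
by rewrite tensZl tensZr scalerA ![ksgn K p _]ksgnC ksgn_add.
Qed.

(** A tensor of degree p is fixed by [spart p], which kills the pure tensors of the other degree;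
    only homogeneous factors of total degree p remain to be tested. *)
Lemma tens_homog_ext (V W : superType K) (U : zmodType) (f h : tensor V W -> U) p :
  {morph f : x y / x + y} -> {morph h : x y / x + y} ->
  (forall q r v w, homog q v -> homog r w -> q (+) r = p ->
    f (tens v w) = h (tens v w)) ->
  forall t, homog p t -> f t = h t.
Proof.
move=> fD hD e t <-; move: t.
have sD := lin_add (@spart_linear K (tensor V W) p).
have z (k : tensor V W -> U) : {morph k : x y / x + y} -> k 0 = 0.
  by move=> kD; apply: (addrI (k 0)); rewrite -kD !addr0.
apply: tens_ext_homog => [s t|s t|q r v w hv hw]; rewrite ?sD ?fD ?hD //.
rewrite (spart_homog _ (homog_tens hv hw)).
by case: eqP => [/esym|_]; [exact: e|rewrite (z f) // (z h)].
Qed.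

Lemma graded_bilinear_add (U V W : superType K) (b c : U -> V -> W) :
  graded_bilinear b -> graded_bilinear c ->
  graded_bilinear (fun u v => b u v + c u v).
Proof.
move=> [bb bg] [cb cg]; split; first exact: bilinear_add.
by move=> p q u v hu hv; apply: homogD; [apply: bg|apply: cg].
Qed.

End SuperLinear.

(** * Operators on the right factor of a tensor product *)

Section Ttwist.
Variables (K : fieldType) (V M N : superType K).

(* 1 (x) f for f of degree p, with the Koszul sign carried by the twist of the
   first factor, so that composition of such maps produces no further signs. *)
Definition ttwist p (f : M -> N) : tensor V M -> tensor V N := tmap (twist p) f.

Lemma ttwistE p f v m : linear f ->
  ttwist p f (tens v m) = tens (twist p v) (f m).
Proof. by move=> fl; apply: tmapE => //; apply: twist_linear. Qed.

Lemma ttwist_linear p f : linear f -> linear (ttwist p f).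
Proof. by move=> fl; apply: tmap_linear => //; apply: twist_linear. Qed.

Lemma eq_ttwist p f h t : f =1 h -> ttwist p f t = ttwist p h t.
Proof. by move=> /funext ->. Qed.

(** The shape [k *: f m + h m] covers both sums and supercommutators, so operator identities on M
    transfer to V (x) M in one rewrite. *)
Lemma ttwistP p k f h t : linear f -> linear h ->
  ttwist p (fun m => k *: f m + h m) t = k *: ttwist p f t + ttwist p h t.
Proof.
move=> fl hl; have fhl : linear (fun m => k *: f m + h m).
  by move=> c x y; rewrite fl hl !scalerDr !scalerA [k * c]mulrC addrACA.
move: t; apply: tens_ext => [s t|s t|v m].
- exact: (lin_add (ttwist_linear p fhl)).
- by rewrite !(lin_add (ttwist_linear p _)) // scalerDr addrACA.
- by rewrite !ttwistE // tensDr tensZr.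
Qed.

Lemma ttwist0 p t : ttwist p (fun=> 0) t = 0.
Proof.
have zl : linear (fun _ : M => 0 : N) by move=> k x y; rewrite scaler0 addr0.
move: t; apply: tens_ext => [s t|s t|v m]; rewrite ?addr0 //.
  exact: (lin_add (ttwist_linear p zl)).
by rewrite ttwistE // tens0r.
Qed.
End Ttwist.

(** * Actions on the right factor, their naturality and rebracketing *)

Section Tact.
Variable K : fieldType.
Implicit Types U V X M N P : superType K.

Lemma ttwist_comp V M N P p q (f : N -> P) (h : M -> N) (t : tensor V M) :
  linear f -> linear h ->
  ttwist p f (ttwist q h t) = ttwist (p (+) q) (fun m => f (h m)) t.
Proof.
move=> fl hl; have fhl := linear_compose fl hl.
move: t; apply: tens_lin_ext => [||v m].
- exact: linear_compose (ttwist_linear p fl) (ttwist_linear q hl).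
- exact: ttwist_linear.
- by rewrite !ttwistE // twist_add.
Qed.

Lemma ttwist_tmap V V' M M' N N' p (f : V -> V') (h : N -> N') (a : M -> N)
    (b : M' -> N') (k : M -> M') (t : tensor V M) :
  linear f -> even_fun f -> linear h -> linear k -> linear a -> linear b ->
  (forall m, h (a m) = b (k m)) ->
  tmap f h (ttwist p a t) = ttwist p b (tmap f k t).
Proof.
move=> fl fe hl kl al bl e; move: t; apply: tens_lin_ext => [||v m].
- exact: linear_compose (tmap_linear fl hl) (ttwist_linear p al).
- exact: linear_compose (ttwist_linear p bl) (tmap_linear fl kl).
- by rewrite ttwistE // !tmapE // ttwistE // twist_even // e.
Qed.

(** The twist depends on the parity of the operator, so x is split into its homogeneous parts; for x
    of degree p the result is [ttwist p (act x)]. *)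
Definition tact V X M (act : X -> M -> M) (x : X) (t : tensor V M) : tensor V M :=
  ttwist false (act (spart false x)) t + ttwist true (act (spart true x)) t.

Section Theory.
Variables (V X M : superType K) (act : X -> M -> M).
Hypothesis actg : graded_bilinear act.
Let actl := actg.1.1.
Let actr := actg.1.2.

Lemma tact_homog p x (t : tensor V M) : homog p x ->
  tact act x t = ttwist p (act x) t.
Proof.
have act0 : act 0 = fun=> 0 by apply/funext => m; exact: lin_zero (actl m).
move=> hx; rewrite /tact !(spart_homog _ hx).
by case: p hx => hx; rewrite /= act0 ttwist0 ?add0r ?addr0.
Qed.

Lemma tactE p q x (v : V) m : homog p x -> homog q v ->
  tact act x (tens v m) = ksgn K p q *: tens v (act x m).
Proof.
move=> hx hv; rewrite (tact_homog _ hx) ttwistE; last exact: actr.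
by rewrite (twist_homog _ hv) tensZl.
Qed.

Lemma tact_graded : graded_bilinear (@tact V X M act).
Proof.
have tl x : linear (@tact V X M act x).
  by apply: linear_plus; apply: ttwist_linear; apply: actr.
split; first split=> // t k x y.
  have e p : act (spart p (k *: x + y)) =
      fun m => k *: act (spart p x) m + act (spart p y) m.
    by apply/funext => m; rewrite linearP actl.
  by rewrite /tact !e !ttwistP // scalerDr addrACA.
move=> p q x t hx ht; apply: (tensor_graded _ _ ht); first exact: tl.
move=> r s v m hv hm; rewrite (tactE _ hx hv); apply: homogZ; rewrite addbCA.
by apply: homog_tens => //; apply: actg.2.
Qed.
End Theory.

Section Maps.
Variables (X M M' : superType K) (act : X -> M -> M) (act' : X -> M' -> M').
Hypotheses (actg : graded_bilinear act) (actg' : graded_bilinear act').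

Lemma tact_tmap V V' (f : V -> V') (h : M -> M') x t :
  linear f -> even_fun f -> linear h -> (forall x m, h (act x m) = act' x (h m)) ->
  tmap f h (tact act x t) = tact act' x (tmap f h t).
Proof.
move=> fl fe hl ha; rewrite /tact (lin_add (tmap_linear fl hl)).
by congr (_ + _); apply: ttwist_tmap => //; (exact: actg.1.2 || exact: actg'.1.2).
Qed.

(** The twist of U (x) V is the product of the twists of its factors, which become an outer and an
    inner twist after rebracketing. *)
Lemma ttwist_assoc U V p (f : M -> M') (t : tensor (tensor U V) M) : linear f ->
  assoc_fun (ttwist p f t) = ttwist p (ttwist p f) (assoc_fun t).
Proof.
move=> fl; have tl W := @ttwist_linear K W _ _ p f fl.
have al := @assoc_linear K.
have tl2 : linear (ttwist (V := U) p (ttwist (V := V) p f)) by apply: ttwist_linear; exact: tl.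
move: t; apply: tens3_lin_ext => [||u v m].
- exact: linear_compose (al _ _ _) (tl _).
- exact: linear_compose tl2 (al _ _ _).
by rewrite ttwistE // assocE (ttwistE _ _ _ (tl _)) ttwistE // twist_tens assocE.
Qed.

(** The ground field is purely even, so moving x past a scalar costs no sign. *)
Lemma tact_left x (t : tensor K^o M) :
  left_fun (tact act x t) = act x (left_fun t).
Proof.
have ll := @left_linear K M; have [[actl actr] _] := actg.
have [[tl tr] _] := tact_graded K^o actg.
move: t; apply: tens_lin_ext => [||c m].
- exact: linear_compose ll (tr x).
- exact: linear_compose (actr x) ll.
move: x; apply: spart_ext => [x y|x y|p x hx].
- by rewrite (lin_add (tl _)) (lin_add ll).
- exact: (lin_add (actl _)).
have hc : homog false c by [].
rewrite (tactE actg _ hx hc) /ksgn andbF scale1r !leftE.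
by rewrite (lin_scale (actr x)).
Qed.
End Maps.

Lemma tact_assoc U V X M (act : X -> M -> M) x (t : tensor (tensor U V) M) :
  graded_bilinear act ->
  assoc_fun (tact act x t) = tact (tact act) x (assoc_fun t).
Proof.
move=> actg; have ag := tact_graded V actg.
have [[tl _] _] := tact_graded (tensor U V) actg.
have [[tl' _] _] := tact_graded U ag.
move: x; apply: spart_ext => [x y|x y|p x hx].
- by rewrite (lin_add (tl _)) (lin_add (@assoc_linear _ _ _ _)).
- exact: (lin_add (tl' _)).
rewrite (tact_homog actg _ hx) (tact_homog ag _ hx) ttwist_assoc; last exact: actg.1.2.
by apply: eq_ttwist => s; rewrite (tact_homog actg _ hx).
Qed.
End Tact.

(** * The weak representation V (x) M with both actions on M alone *)

Section GradedModules.
Variables (K : fieldType) (A : superComAlgType K).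

Lemma graded_Amodule_comm (M : superType K) (act : A -> M -> M) p q a b m :
  is_graded_Amodule act -> homog p a -> homog q b ->
  act a (act b m) = ksgn K p q *: act b (act a m).
Proof.
move=> [[[al _] _] _ aM] ha hb.
by rewrite -!aM (smulC _ _ _ _ ha hb) (lin_scale (al m)).
Qed.

Lemma tact_Amodule (V M : superType K) (act : A -> M -> M) :
  is_graded_Amodule act -> is_graded_Amodule (@tact K V A M act).
Proof.
move=> [ag a1 aM]; have [[tl tr] tg] := tact_graded V ag.
have [[ml mr] mg] := @smul_graded K A.
split=> // [t|a b t].
  rewrite (tact_homog ag _ (@sone_even K A)).
  move: t; apply: tens_ext_homog => [s t|//|p q v m hv hm].
    exact: (lin_add (ttwist_linear _ (ag.1.2 _))).
  rewrite ttwistE; last exact: ag.1.2.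
  by rewrite (twist_homog _ hv) /ksgn scale1r a1.
move: a; apply: spart_ext => [a a'|a a'|p a ha].
- by rewrite (lin_add (ml b)) (lin_add (tl t)).
- exact: (lin_add (tl _)).
move: b; apply: spart_ext => [b b'|b b'|q b hb].
- by rewrite (lin_add (mr a)) (lin_add (tl t)).
- by rewrite (lin_add (tl t)) (lin_add (tr a)).
rewrite (tact_homog ag _ (mg _ _ _ _ ha hb)) (tact_homog ag _ ha) (tact_homog ag _ hb).
by rewrite ttwist_comp; [apply: eq_ttwist => m; exact: aM|exact: ag.1.2|exact: ag.1.2].
Qed.

Variables (L : lieSuperType K) (E : lie_rinehart A L).

(** Since [ttwist] respects composition and linear combination without further signs, each axiom is
    the image of the same axiom for M. *)
Lemma tact_weak_rep (V M : superType K) (actA : A -> M -> M) (actL : L -> M -> M) :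
  is_weak_rep E actA actL -> is_weak_rep E (@tact K V _ _ actA) (@tact K V _ _ actL).
Proof.
move=> [hA [lg lbr] hw]; have [ag _ _] := hA.
split; first exact: tact_Amodule.
- split=> [|p q x y t hx hy]; first exact: tact_graded.
  have hxy := (@sbr_graded K L).2 _ _ _ _ hx hy.
  rewrite (tact_homog lg _ hxy) !(tact_homog lg _ hx) !(tact_homog lg _ hy).
  have cl z z' := linear_compose (lg.1.2 z) (lg.1.2 z').
  rewrite !ttwist_comp ?[q (+) p]addbC; try exact: lg.1.2.
  (* The two terms merge into a single operator on M, with minus the Koszul sign as coefficient. *)
  rewrite addrC -scaleNr -ttwistP; [|exact: cl|exact: cl].
  by apply: eq_ttwist => m; rewrite (lbr _ _ _ _ _ hx hy) addrC scaleNr.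
- move=> p q x a t hx ha.
  have [_ [_ ad _] _ _] := lr_axioms E; have [_ hd _] := ad _ _ hx.
  rewrite (tact_homog ag _ (hd _ _ ha)) !(tact_homog lg _ hx) !(tact_homog ag _ ha).
  rewrite !ttwist_comp ?[q (+) p]addbC; try (exact: lg.1.2 || exact: ag.1.2).
  rewrite addrC -ttwistP; first 1 last.
  + exact: linear_compose (ag.1.2 a) (lg.1.2 x).
  + exact: ag.1.2.
  by apply: eq_ttwist => m; rewrite (hw _ _ _ _ _ hx ha) addrC.
Qed.
End GradedModules.

(** * The action of g on the left factor *)

Section Lop.
Variables (K : fieldType) (g : lieSuperType K).
Implicit Types U V : lie_module g.

Definition lop V (M : superType K) (l : g) : tensor V M -> tensor V M :=
  tmap (lm_act l) (fun m : M => m).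

Section LopFacts.
Variables (V : lie_module g) (M : superType K).

Lemma lopE l (v : V) (m : M) : lop l (tens v m) = tens (lm_act l v) m.
Proof. by apply: tmapE => //; apply: lm_actl. Qed.

Lemma lop_linear l : linear (@lop V M l).
Proof. by apply: tmap_linear => //; apply: lm_actl. Qed.

Lemma lop_linearl (t : tensor V M) : linear (fun l => lop l t).
Proof.
move=> k l l'; have lD l := lin_add (lop_linear l).
move: t; apply: tens_ext => [s t|s t|v m]; rewrite ?lD //.
  by rewrite scalerDr addrACA.
by rewrite !lopE (lm_actr v) tensDl tensZl.
Qed.

(** The sign arises because l shifts the degree of v by p, and on the left the twist is evaluated
    after l has acted. *)
Lemma ttwist_lop p q l (f : M -> M) (t : tensor V M) : linear f -> homog p l ->
  ttwist q f (lop l t) = ksgn K q p *: lop l (ttwist q f t).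
Proof.
move=> fl hl; have fD := lin_add (ttwist_linear (V := V) q fl).
have lD := lin_add (lop_linear l).
move: t; apply: tens_ext_homog => [s t|s t|r r' v m hv hm].
- by rewrite lD fD.
- by rewrite fD lD scalerDr.
rewrite lopE !ttwistE // lopE (twist_homog _ hv) (lin_scale (lm_actl l)).
rewrite (twist_homog _ (lm_act_graded hl hv)) !tensZl scalerA.
by rewrite ksgnC ksgn_add ![ksgn K q _]ksgnC.
Qed.

Lemma tact_lop (X : superType K) (act : X -> M -> M) p q l x (t : tensor V M) :
  graded_bilinear act -> homog p l -> homog q x ->
  tact act x (lop l t) = ksgn K q p *: lop l (tact act x t).
Proof.
move=> ag hl hx; rewrite !(tact_homog ag _ hx).
by apply: ttwist_lop => //; exact: ag.1.2.
Qed.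

Lemma lop_br p q l l' (t : tensor V M) : homog p l -> homog q l' ->
  lop (sbr l l') t = lop l (lop l' t) - ksgn K p q *: lop l' (lop l t).
Proof.
move=> hl hl'; have lD l := lin_add (lop_linear l).
move: t; apply: tens_ext => [s t|s t|v m]; rewrite ?lD //.
  by rewrite scalerDr opprD addrACA.
rewrite !lopE (lm_act_br _ hl hl') -scaleNr addrC tensDl tensZl addrC.
by rewrite scaleNr.
Qed.

Lemma lop_graded p q l (t : tensor V M) : homog p l -> homog q t ->
  homog (p (+) q) (lop l t).
Proof.
move=> hl ht; apply: (tensor_graded _ _ ht); first exact: lop_linear.
move=> r s v m hv hm; rewrite lopE addbA.
by apply: homog_tens => //; apply: lm_act_graded.
Qed.
End LopFacts.

(** The sign (-1)^(|l||u|) in the coproduct of l is exactly the twist on U, so the term where l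
    meets V is [ttwist p] of an operator on V (x) M. *)
Lemma lop_assoc U V (M : superType K) p l (t : tensor (lm_tensor U V) M) :
  homog p l ->
  assoc_fun (lop l t) = ttwist p (@lop V M l) (assoc_fun t) +
    @lop U (tensor V M) l (assoc_fun t).
Proof.
move=> hl; have al := @assoc_linear K U V M.
have tl := ttwist_linear (V := U) p (@lop_linear V M l).
have ll := @lop_linear U (tensor V M) l.
move: t; apply: tens3_lin_ext => [||u v m].
- exact: linear_compose al (@lop_linear (lm_tensor U V) M l).
- exact: linear_plus (linear_compose tl al) (linear_compose ll al).
rewrite (lopE (V := lm_tensor U V)) assocE ttwistE ?lopE; last exact: lop_linear.
(* Writing the Koszul sign as [twist p u] makes the coproduct formula valid for u of mixed
   degree. *)
have -> : lm_act l (tens u v : lm_tensor U V) =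
    tens (lm_act l u) v + tens (twist p u) (lm_act l v).
  move: u; apply: spart_ext => [u u'|u u'|q u hu].
  - by rewrite tensDl; exact: (lin_add (@tensor_act_linear _ _ U V l)).
  - by rewrite (lin_add (lm_actl l)) twistD !tensDl addrACA.
  by rewrite [LHS](tensor_actE _ hl hu) (twist_homog _ hu) tensZl.
by rewrite tensDl (lin_add al) !assocE addrC.
Qed.
End Lop.

(** The supercommutator of two sums sigma + rho, expanded: a and b come from sigma with sigma, h and
    i from rho with rho, and c, d, e, f from the mixed products. The Koszul sign k squares to 1,
    which frees f of its coefficient. *)
Lemma super_commutator_add (K : fieldType) (V : lmodType K) (k : K)
    (a b c d e f h i : V) : k * k = 1 ->
  a - k *: b + (c - k *: d - k *: (e - k *: f) + (h - k *: i)) =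
  a + c + (f + h) - k *: (b + e + (d + i)).
Proof.
move=> k1; rewrite scalerBr scalerA k1 scale1r !scalerDr !opprD opprK !addrA.
by rewrite [LHS](ACl (1*3*6*7*2*5*4*8)).
Qed.

(** * The action of g (x) A on V (x) M *)

Section TensorAlgebraAction.
Variables (K : fieldType) (A : superComAlgType K) (g : lieSuperType K).
Implicit Types U V : lie_module g.

(* The action of g (x) A on V (x) M: for homogeneous b and v,
   (l (x) b)(v (x) m) = (-1)^(|b||v|) l v (x) b m. *)
Definition cact V (M : superType K) (act : A -> M -> M) (s : tensor g A)
    (t : tensor V M) : tensor V M :=
  tlift (fun l b => lop l (tact act b t)) s.

Section OneModule.
Variables (V : lie_module g) (M : superType K) (act : A -> M -> M).
Hypothesis hA : is_graded_Amodule act.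
Let ag : graded_bilinear act. Proof. by case: hA. Qed.
Let al := (tact_graded V ag).1.1.
Let ar := (tact_graded V ag).1.2.
Let hT := tact_Amodule V hA.

Lemma cact_bilin (t : tensor V M) :
  is_bilinear (fun (l : g) (b : A) => lop l (tact act b t)).
Proof.
split=> [b|l]; first exact: lop_linearl.
exact: linear_compose (@lop_linear _ _ V M l) (al t).
Qed.

Lemma cact_linearl (t : tensor V M) : linear (fun s => cact act s t).
Proof. exact/tlift_linear/cact_bilin. Qed.

Lemma cactE l b (t : tensor V M) : cact act (tens l b) t = lop l (tact act b t).
Proof. exact/tlift_tens/cact_bilin. Qed.

Lemma cact_linear s : linear (@cact V M act s).
Proof.
move=> k t u; move: s; apply: tens_ext => [s s'|s s'|l b].
- exact: (lin_add (cact_linearl _)).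
- by rewrite !(lin_add (cact_linearl _)) scalerDr addrACA.
by rewrite !cactE ar lop_linear.
Qed.

Lemma cact_tens p q l b (v : V) (m : M) : homog p b -> homog q v ->
  cact act (tens l b) (tens v m) = ksgn K p q *: tens (lm_act l v) (act b m).
Proof.
move=> hb hv; rewrite cactE (tactE ag _ hb hv) (lin_scale (lop_linear l)).
by rewrite lopE.
Qed.

Lemma cact_graded : graded_bilinear (@cact V M act).
Proof.
split; first by split; [exact: cact_linearl|exact: cact_linear].
move=> p q s t hs ht; rewrite addbC; move: hs.
apply: (tensor_graded (f := fun s => cact act s t)); first exact: cact_linearl.
move=> r r' l b hl hb; rewrite cactE addbCA; apply: lop_graded => //.
by rewrite addbC; apply: (tact_graded V ag).2.
Qed.

(** The operators of g and of A supercommute, as do those of A among themselves; sorting all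
    products into the order l, l', a, b leaves the bracket of g. *)
Lemma cact_br p q s s' (t : tensor V M) : homog p s -> homog q s' ->
  cact act (tensor_br s s') t =
    cact act s (cact act s' t) - ksgn K p q *: cact act s' (cact act s t).
Proof.
have cD t' := lin_add (cact_linearl t'); have cD' s0 := lin_add (cact_linear s0).
have bD s0 : {morph (fun s => tensor_br (A := A) (g := g) s s0) : x y / x + y}.
  exact/lin_add/tlift_linear/tensor_br_bilin2.
have bD' s0 : {morph tensor_br (A := A) (g := g) s0 : x y / x + y}.
  apply/lin_add/tlift_linear_param; first exact: tensor_br_bilin2.
  by move=> l b; exact/tlift_linear/tensor_br_bilin1.
move=> hs hs'; move: s hs; apply: tens_homog_ext => [s u|s u|r1 r2 l a hl ha e].
- by rewrite bD cD.
- by rewrite !cD cD' scalerDr opprD addrACA.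
move: s' hs'; apply: tens_homog_ext => [s u|s u|r3 r4 l' b hl' hb e'].
- by rewrite bD' cD.
- by rewrite !cD cD' scalerDr opprD addrACA.
rewrite (tensor_brE _ _ ha hl') (lin_scale (cact_linearl t)) !cactE.
rewrite (lop_br _ hl hl') (tact_lop _ ag hl' ha) (tact_lop _ ag hl hb).
rewrite !(lin_scale (lop_linear _)).
have [_ _ tM] := hT; rewrite tM (graded_Amodule_comm _ hT hb ha).
rewrite !(lin_scale (lop_linear _)) scalerBr !scalerA; congr (_ - _ *: _).
(* The operators now agree; what is left is a sign identity in the parities of l, a, l' and b,
   checked case by case. *)
rewrite -e -e'.
by case: r1 {hl e}; case: r2 {ha}; case: r3 {hl' e'}; case: r4 {hb};
  rewrite /ksgn /= ?expr0 ?expr1 ?mulN1r ?mulrN1 ?opprK ?mulr1.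
Qed.

(** The element a supercommutes with both factors of l (x) b, because A is supercommutative and l
    acts on V only. *)
Lemma cact_tact p q s a (t : tensor V M) : homog p s -> homog q a ->
  cact act s (tact act a t) = ksgn K p q *: tact act a (cact act s t).
Proof.
have cD t' := lin_add (cact_linearl t').
move=> hs ha; move: s hs; apply: tens_homog_ext => [s u|s u|r1 r2 l b hl hb e].
- by rewrite cD.
- by rewrite cD (lin_add (ar a)) scalerDr.
rewrite !cactE (graded_Amodule_comm _ hT hb ha) (tact_lop _ ag hl ha).
rewrite (lin_scale (lop_linear _)) scalerA -e ksgn_add [ksgn K q r1]ksgnC.
by rewrite mulrC mulrA ksgn_sqr mul1r.
Qed.
End OneModule.

Lemma cact_tmap V V' (M M' : superType K) (act : A -> M -> M) (act' : A -> M' -> M')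
    (f : lie_module_hom V V') (h : M -> M') s (t : tensor V M) :
  is_graded_Amodule act -> is_graded_Amodule act' -> linear h ->
  (forall a m, h (act a m) = act' a (h m)) ->
  tmap f h (cact act s t) = cact act' s (tmap f h t).
Proof.
move=> hA hA' hl ha; have fl := lm_fun_linear f.
have fhl := tmap_linear fl hl.
have [ag _ _] := hA; have [ag' _ _] := hA'.
move: s; apply: tens_ext => [s s'|s s'|l b].
- by rewrite (lin_add (cact_linearl hA t)) (lin_add fhl).
- exact: (lin_add (cact_linearl hA' _)).
rewrite !cactE // -(tact_tmap ag ag' _ _ fl (@lm_fun_even _ _ _ _ f) hl ha).
move: (tact act b t); apply: tens_lin_ext => [||v m].
- exact: linear_compose fhl (lop_linear l).
- exact: linear_compose (lop_linear l) fhl.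
by rewrite lopE !tmapE // lopE lm_fun_act.
Qed.

(** On l (x) b this is the coproduct formula [lop_assoc] applied after b; in either term b reaches M
    past both U and V. *)
Lemma cact_assoc U V (M : superType K) (act : A -> M -> M) p s
    (t : tensor (lm_tensor U V) M) :
  is_graded_Amodule act -> homog p s ->
  assoc_fun (cact act s t) =
    ttwist p (@cact V M act s) (assoc_fun t) +
    @cact U (tensor V M) (tact act) s (assoc_fun t).
Proof.
move=> hA hs; have [ag _ _] := hA; have hT := tact_Amodule V hA.
have al := lin_add (@assoc_linear K U V M).
have cl := @cact_linear V M act hA.
move: s hs; apply: tens_homog_ext => [s s'|s s'|q r l b hl hb e].
- by rewrite (lin_add (cact_linearl hA t)) al.
(* The coefficient 1 gives the sum the shape that [ttwistP] expects. *)
- have -> : @cact V M act (s + s') = fun t => 1 *: cact act s t + cact act s' t.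
    by apply/funext => u; rewrite (lin_add (cact_linearl hA u)) scale1r.
  rewrite (ttwistP _ _ _ (cl s) (cl s')) scale1r.
  by rewrite (lin_add (cact_linearl hT _)) addrACA.
rewrite !cactE // (lop_assoc _ hl) tact_assoc //; congr (_ + _).
rewrite (tact_homog (tact_graded V ag) _ hb) ttwist_comp ?e.
- by apply: eq_ttwist => u; rewrite cactE.
- exact: lop_linear.
- exact: (tact_graded V ag).1.2.
Qed.

(** Every l acts by zero on the trivial module. *)
Lemma cact_left (M : superType K) (act : A -> M -> M) s (t : tensor (lm_triv g) M) :
  is_graded_Amodule act -> cact act s t = 0.
Proof.
move=> hA; move: s; apply: tens_ext => [s s'|s s'|l b]; rewrite ?addr0 //.
  exact: (lin_add (cact_linearl hA _)).
rewrite cactE //; move: (tact _ _ _); apply: tens_ext => [u u'|u u'|v m].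
- exact: (lin_add (lop_linear l)).
- by rewrite addr0.
by rewrite lopE tens0l.
Qed.
End TensorAlgebraAction.

(** * The weak representation on V (x) M defined by a crossed homomorphism *)

Section CrossedRepresentation.
Variables (K : fieldType) (A : superComAlgType K) (L g : lieSuperType K).
Variables (E : lie_rinehart A L) (H : L -> tensor g A).
Hypothesis hH : even_crossed_hom E H.

Section Action.
Variables (V : lie_module g) (M : superType K).
Variables (actA : A -> M -> M) (actL : L -> M -> M).
Hypothesis hM : is_weak_rep E actA actL.

(** Moving x past l (x) b gives a sign at l; at b the Leibniz rule of M yields the anchor term,
    which is [crossed_act]. *)
Lemma tact_cact p q x s (t : tensor V M) : homog p x -> homog q s ->
  tact actL x (cact actA s t) =
    cact actA (crossed_act E x s) t + ksgn K p q *: cact actA s (tact actL x t).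
Proof.
have [hA [lg _] _] := hM; have [_ _ hw] := tact_weak_rep V hM.
have [[_ lr] _] := tact_graded V lg.
have cD t' := lin_add (cact_linearl hA t').
move=> hx hs; move: s hs; apply: tens_homog_ext => [s u|s u|r1 r2 l b hl hb e].
- by rewrite cD (lin_add (lr x)).
- by rewrite (lin_add (crossed_act_linear E x)) !cD scalerDr addrACA.
rewrite (crossed_actE _ _ hx hl) (lin_scale (cact_linearl hA t)) !cactE //.
rewrite (tact_lop _ lg hl hx) (hw _ _ _ _ _ hx hb) (lin_add (lop_linear l)).
rewrite (lin_scale (lop_linear l)) scalerDr scalerA -e.
by rewrite [ksgn K p (_ (+) _)]ksgnC ksgn_add ![ksgn K _ p]ksgnC.
Qed.

Definition crossed_actL (x : L) (t : tensor V M) : tensor V M :=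
  tact actL x t + cact actA (H x) t.

(** The Leibniz rule already holds for sigma, and rho supercommutes with A, so adding rho o H
    preserves it. *)
Lemma crossed_weak_rep : is_weak_rep E (@tact K V A M actA) crossed_actL.
Proof.
have [hA [lg _] _] := hM; have [ag _ _] := hA; have [tA [tg tbr] tw] := tact_weak_rep V hM.
have [Hl He Hbr] := hH.
have [[cl cr] cg] := cact_graded V hA.
split=> //; first split.
- apply: (graded_bilinear_add (c := fun x => cact actA (H x)) tg); split; first split=> [t|x].
  + exact: (@linear_compose _ _ _ _ (fun s => cact actA s t) H (cl t) Hl).
  + exact: cr.
  + by move=> p q x t /He; apply: cg.
- move=> p q x y t hx hy; rewrite /crossed_actL (tbr _ _ _ _ _ hx hy).
  rewrite (Hbr _ _ _ _ hx hy) !(lin_add (cl t)) (lin_opp (cl t)).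
  rewrite (lin_scale (cl t)) (cact_br hA _ (He _ _ hx) (He _ _ hy)).
  (* Here [tact_cact] is solved for its [crossed_act] term, giving the supercommutator of sigma(x)
     and rho(H y); next the same with x and y exchanged. *)
  rewrite (canRL (addrK _) (esym (tact_cact t hx (He _ _ hy)))).
  rewrite (canRL (addrK _) (esym (tact_cact t hy (He _ _ hx)))).
  rewrite [ksgn K q p]ksgnC super_commutator_add ?ksgn_sqr //.
  by rewrite !(lin_add (tg.1.2 _), lin_add (cr _)).
- move=> p q x a t hx ha; rewrite /crossed_actL (tw _ _ _ _ _ hx ha).
  rewrite (cact_tact hA _ (He _ _ hx) ha) -addrA -scalerDr.
  by rewrite -(lin_add ((tact_graded V ag).1.2 a)).
Qed.
End Action.

Definition crossed_rep (V : lie_module g) (M : weak_rep E) : weak_rep E :=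
  WeakRep (crossed_weak_rep V (wr_axioms M)).

(** A linear inverse of a morphism is automatically even and equivariant, so the constraints need
    only inverses as linear maps. *)
Lemma weak_rep_iso (M N : weak_rep E) (f : weak_rep_hom M N) (h : N -> M) :
  linear h -> cancel f h -> cancel h f -> @is_iso (WMod E) M N f.
Proof.
move=> hl fK hK; have fl := wr_fun_linear f.
have he : even_fun h.
  move=> p n hn; rewrite /homog -[LHS]fK -[RHS]fK; congr h; rewrite hK.
  (* With n = f m the claim becomes that f commutes with [spart p], which follows by splitting m
     into its two parts. *)
  rewrite -[RHS]hn -{2}[n]hK; move: (h n) => m.
  have fu q := wr_fun_even f (homog_spart q m).
  rewrite -{2}[m](spart_sumb p) (lin_add fl) linearD /= (fu p).
  by rewrite (spart_homog p (fu (~~ p))); case: (p) => /=; rewrite addr0.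
have hA a n : h (wr_actA a n) = wr_actA a (h n).
  by rewrite -{1}[n]hK -wr_fun_actA fK.
have hL x n : h (wr_actL x n) = wr_actL x (h n).
  by rewrite -{1}[n]hK -wr_fun_actL fK.
by exists (WeakRepHom hl he hA hL); split; apply: weak_rep_hom_eq.
Qed.

Let wA (M : weak_rep E) : is_graded_Amodule (@wr_actA _ _ _ _ M).
Proof. by have [] := wr_axioms M. Qed.
Let wAg (M : weak_rep E) : graded_bilinear (@wr_actA _ _ _ _ M).
Proof. by have [] := wA M. Qed.
Let wLg (M : weak_rep E) : graded_bilinear (@wr_actL _ _ _ _ M).
Proof. by have [_ []] := wr_axioms M. Qed.

(** * Functoriality *)

Section Bimap.
Variables (V V' : lie_module g) (M M' : weak_rep E).
Variables (f : lie_module_hom V V') (h : weak_rep_hom M M').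
Let fl := lm_fun_linear f.
Let hl := wr_fun_linear h.

Fact crossed_bimap_even :
  @even_fun K (crossed_rep V M) (crossed_rep V' M') (tmap f h).
Proof.
move=> p t; apply: (tensor_graded (r := false) (tmap_linear fl hl)).
move=> q r v m hv hm; rewrite tmapE //.
exact: (homog_tens (lm_fun_even f hv) (wr_fun_even h hm)).
Qed.

Fact crossed_bimap_actA a (t : crossed_rep V M) :
  tmap f h (wr_actA a t) = @wr_actA _ _ _ _ (crossed_rep V' M') a (tmap f h t).
Proof.
apply: tact_tmap => //; first exact: lm_fun_even.
exact: wr_fun_actA.
Qed.

Fact crossed_bimap_actL x (t : crossed_rep V M) :
  tmap f h (wr_actL x t) = @wr_actL _ _ _ _ (crossed_rep V' M') x (tmap f h t).
Proof.
rewrite [LHS](lin_add (tmap_linear fl hl)); congr (_ + _).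
  apply: tact_tmap => //; first exact: lm_fun_even.
  exact: wr_fun_actL.
by apply: cact_tmap => //; exact: wr_fun_actA.
Qed.

Definition crossed_bimap : weak_rep_hom (crossed_rep V M) (crossed_rep V' M') :=
  @WeakRepHom _ _ _ _ (crossed_rep V M) (crossed_rep V' M') (tmap f h)
    (tmap_linear fl hl) crossed_bimap_even crossed_bimap_actA crossed_bimap_actL.
End Bimap.

(** * The associativity constraint *)

Section Assoc.
Variables (U V : lie_module g) (M : weak_rep E).
Let S := crossed_rep (lm_tensor U V) M.
Let T := crossed_rep U (crossed_rep V M).

Fact crossed_assoc_even : @even_fun K S T (@assoc_fun K U V M).
Proof.
move=> p t; apply: (tensor_graded (r := false) (@assoc_linear K U V M)).
exact: assoc_graded.
Qed.

Fact crossed_assoc_actA a (t : S) :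
  assoc_fun (wr_actA a t) = @wr_actA _ _ _ _ T a (assoc_fun t).
Proof. exact: tact_assoc. Qed.

(** Both sides consist of sigma(x) on M, rho(H x) on V (x) M under a twist of U, and rho(H x) with g
    acting on U. For homogeneous x evenness of H makes H x homogeneous, as [cact_assoc] requires. *)
Fact crossed_assoc_actL x (t : S) :
  assoc_fun (wr_actL x t) = @wr_actL _ _ _ _ T x (assoc_fun t).
Proof.
have al := lin_add (@assoc_linear K U V M).
have sl := (wLg S).1.1 t; have tl := (wLg T).1.1 (assoc_fun t).
move: x; apply: spart_ext => [x y|x y|p x hx].
- by rewrite (lin_add sl); apply: al.
- exact: (lin_add tl).
have [_ He _] := hH.
rewrite [LHS]al tact_assoc // (@cact_assoc _ _ _ U V M _ p) //; last exact: He.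
rewrite addrA; congr (_ + _).
have lg := wLg (crossed_rep V M); have lg' := tact_graded V (wLg M).
rewrite (tact_homog lg' _ hx) [RHS](tact_homog lg _ hx).
(* The two terms that act on V (x) M merge into [ttwist p] of the whole action of x there. *)
rewrite -[X in X + _]scale1r -ttwistP; first 1 last.
- exact: lg'.1.2.
- exact: cact_linear.
by apply: eq_ttwist => u; rewrite scale1r.
Qed.

Definition crossed_assoc : weak_rep_hom S T :=
  @WeakRepHom _ _ _ _ S T (@assoc_fun K U V M) (@assoc_linear K U V M)
    crossed_assoc_even crossed_assoc_actA crossed_assoc_actL.
End Assoc.

(** * The unit constraint *)

Section Unit.
Variable M : weak_rep E.
Let S := crossed_rep (lm_triv g) M.

Fact crossed_left_even : @even_fun K S M (@left_fun K M).
Proof.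
move=> p t; apply: (tensor_graded (r := false) (@left_linear K M)).
exact: left_graded.
Qed.

Fact crossed_left_actA a (t : S) :
  left_fun (wr_actA a t) = wr_actA a (left_fun t : M).
Proof. exact: tact_left. Qed.

(** The term of H vanishes on the trivial module, leaving the action of x on M. *)
Fact crossed_left_actL x (t : S) :
  left_fun (wr_actL x t) = wr_actL x (left_fun t : M).
Proof.
rewrite [LHS](lin_add (@left_linear K M)) cact_left //.
by rewrite (lin_zero (@left_linear K M)) addr0; apply: tact_left.
Qed.

Definition crossed_left : weak_rep_hom S M :=
  @WeakRepHom _ _ _ _ S M (@left_fun K M) (@left_linear K M)
    crossed_left_even crossed_left_actA crossed_left_actL.
End Unit.

(** * Assembly of the module category *)

Fact crossed_bimap_id V M :
  crossed_bimap (lmid V) (wid M) = wid (crossed_rep V M).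
Proof. by apply: weak_rep_hom_eq => t; exact: (@tmap_id K V M t). Qed.

Fact crossed_bimap_comp V V' V'' M M' M'' (f' : lie_module_hom V' V'')
    (f : lie_module_hom V V') (h' : weak_rep_hom M' M'') (h : weak_rep_hom M M') :
  crossed_bimap (lmcomp f' f) (wcomp h' h) =
  wcomp (crossed_bimap f' h') (crossed_bimap f h).
Proof.
apply: weak_rep_hom_eq => t.
exact: (tmap_comp (lm_fun_linear f') (lm_fun_linear f) (wr_fun_linear h')
  (wr_fun_linear h)).
Qed.

Definition crossed_bifun :
    @bifunctor_on (Mod g) (WMod E) (WMod E) crossed_rep :=
  @Bifunctor (Mod g) (WMod E) (WMod E) crossed_rep crossed_bimap crossed_bimap_id
    crossed_bimap_comp.

(** Morphisms are determined by their underlying maps, so naturality, pentagon and triangle reduce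
    to the corresponding identities for tensor products of vector spaces. *)
Definition crossed_module_category :
  @module_category_on (Mod g) (WMod E) crossed_rep.
Proof.
apply: (@ModuleCategory (Mod g) (WMod E) crossed_rep crossed_bifun crossed_assoc
  crossed_left).
- move=> U V M; apply: (@weak_rep_iso _ _ (crossed_assoc U V M) (@associ_fun K U V M)).
  + exact: associ_linear.
  + exact: assocK.
  + exact: associK.
- move=> M; apply: (@weak_rep_iso _ _ (crossed_left M) (tens (1 : K^o))).
  + exact: (tens_bilinear _ _).2.
  + exact: leftK.
  + exact: leftVK.
- move=> U U' V V' M M' f h k; apply: weak_rep_hom_eq => t.
  exact: (assoc_nat (lm_fun_linear f) (lm_fun_linear h) (wr_fun_linear k) t).
- move=> M M' f; apply: weak_rep_hom_eq => t.
  exact: (left_nat (wr_fun_linear f) t).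
- by move=> U V W M; apply: weak_rep_hom_eq => t; exact: assoc_pentagon t.
- by move=> U M; apply: weak_rep_hom_eq => t; exact: assoc_triangle t.
Defined.
End CrossedRepresentation.

Theorem theorem4p5 (R : realType) (A : superComAlgType R[i])
    (L g : lieSuperType R[i]) (E : lie_rinehart A L)
    (H : L -> tensor g A) (hH : even_crossed_hom E H) :
  exists (actA : forall (V : lie_module g) (M : weak_rep E),
                   A -> tensor V M -> tensor V M)
         (actL : forall (V : lie_module g) (M : weak_rep E),
                   L -> tensor V M -> tensor V M)
         (wr : forall (V : lie_module g) (M : weak_rep E),
                 is_weak_rep E (actA V M) (actL V M)),
  [/\ forall (V : lie_module g) (M : weak_rep E) (p q r : bool)
          (a : A) (v : V) (m : M),
        homog p a -> homog q v -> homog r m ->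
        actA V M a (tens v m) = ksgn R[i] p q *: tens v (wr_actA a m),
      forall (V : lie_module g) (M : weak_rep E) (p q r : bool)
          (x : L) (v : V) (m : M)
          (n : nat) (pl pa : 'I_n -> bool) (l : 'I_n -> g) (a : 'I_n -> A),
        homog p x -> homog q v -> homog r m ->
        (forall i, homog (pl i) (l i)) -> (forall i, homog (pa i) (a i)) ->
        H x = \sum_(i < n) tens (l i) (a i) ->
        actL V M x (tens v m) =
          ksgn R[i] p q *: tens v (wr_actL x m)
          + \sum_(i < n)
              ksgn R[i] (pa i) q *: tens (lm_act (l i) v) (wr_actA (a i) m)
    & let F : Mod g -> WMod E -> WMod E := fun V M => WeakRep (wr V M) in
      exists S : module_category_on F,
      [/\ forall (V V' : Mod g) (M M' : WMod E)
            (f : lie_module_hom V V') (h : weak_rep_hom M M') v m,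
            (bimap (mod_bifun S) f h : weak_rep_hom (F V M) (F V' M'))
              (tens v m) = tens (f v) (h m),
          forall (U V : Mod g) (M : WMod E) u v m,
            (mod_assoc S U V M :
               weak_rep_hom (F (lm_tensor U V) M) (F U (F V M)))
              (tens (tens u v) m) = tens u (tens v m)
        & forall (M : WMod E) (c : R[i]^o) m,
            (mod_unit S M : weak_rep_hom (F (lm_triv g) M) M)
              (tens c m) = (c : R[i]) *: m]].
Proof.
have hA (M : weak_rep E) : is_graded_Amodule (@wr_actA _ _ _ _ M) by have [] := wr_axioms M.
have [ag lg] : (forall M : weak_rep E, graded_bilinear (@wr_actA _ _ _ _ M)) /\
    (forall M : weak_rep E, graded_bilinear (@wr_actL _ _ _ _ M)).
  by split=> M; [have [] := hA M|have [_ []] := wr_axioms M].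
exists (fun V M => tact (@wr_actA _ _ _ _ M)),
  (fun V M => crossed_actL H (@wr_actA _ _ _ _ M) (@wr_actL _ _ _ _ M)),
  (fun V M => crossed_weak_rep hH V (wr_axioms M)); split.
- by move=> V M p q r a v m ha hv _; apply: (tactE (ag M) _ ha hv).
- move=> V M p q r x v m n pl pa l a hx hv _ _ ha e.
  rewrite /crossed_actL (tactE (lg M) _ hx hv) e; congr (_ + _).
  (* Linearity of [cact] in its first argument gives the formula for any decomposition of [H x]. *)
  have cl := cact_linearl (hA M) (tens v m).
  rewrite (big_morph _ (lin_add cl) (lin_zero cl)); apply: eq_bigr => i _.
  exact: (cact_tens (hA M) _ _ (ha i) hv).
- exists (crossed_module_category hH); split.
  + move=> V V' M M' f h v m.
    exact: (tmapE _ _ (lm_fun_linear f) (wr_fun_linear h)).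
  + by move=> U V M u v m; exact: assocE.
  + by move=> M c m; exact: leftE.
Qed.
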